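(* Let $A$ and $B$ be separable $C^*$-algebras, let $I_{A,-}:KK(A,-)\to E(A,-)$ be the natural transformation with $I_{A,A}(\gamma^A)=\beta^A$, and let $f^A=I_{A,qA}(\mathrm{id}_{qA\otimes\mathcal K}):S^2A\otimes\mathcal K\to qA\otimes\mathcal K$. Then $I_{A,B}(\phi)=\phi\circ f^A$ in $E(A,B)$ for every $\phi\in KK(A,B)=[qA\otimes\mathcal K,B\otimes\mathcal K]$.
   Context: All $C^*$-algebras are separable; $\mathcal K$ is the $C^*$-algebra of compact operators on a separable infinite-dimensional Hilbert space; $S^2A=C_0(\mathbb R^2)\otimes A$. An asymptotic morphism from $A$ to $B$ is a family of maps $(\phi_t)_{t\in[0,\infty)}:A\to B$ such that $t\mapsto\phi_t(a)$ is continuous for each $a$, and $\|\phi_t(a^* )-\phi_t(a)^*\|$, $\|\phi_t(a+\lambda b)-\phi_t(a)-\lambda\phi_t(b)\|$, $\|\phi_t(ab)-\phi_t(a)\phi_t(b)\|$ tend to $0$ as $t\to\infty$ for all $a,b\in A$, $\lambda\in\mathbb C$. Two asymptotic morphisms $A\to B$ are homotopic if they are the evaluations at $0$ and $1$ of an asymptotic morphism $A\to C([0,1],B)$. $[[A,B]]$ is the set of homotopy classes of asymptotic morphisms, $[A,B]$ the set of homotopy classes of $*$-homomorphisms. The algebra $qA$: let $A*A$ be the free product with canonical inclusions $i_1^A,i_2^A:A\to A*A$; $qA$ is the closed two-sided ideal of $A*A$ generated by $\{i_1^A(x)-i_2^A(x):x\in A\}$. For $*$-homomorphisms $\phi,\psi:A\to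 B$, $q(\phi,\psi)$ is the restriction to $qA$ of the unique $*$-homomorphism $Q(\phi,\psi):A*A\to B$ with $Q(\phi,\psi)\circ i_1^A=\phi$, $Q(\phi,\psi)\circ i_2^A=\psi$. $E(A,B):=[[S^2A\otimes\mathcal K,B\otimes\mathcal K]]$ and $KK(A,B):=[qA\otimes\mathcal K,B\otimes\mathcal K]$ are abelian groups, covariantly functorial in $B$: any $*$-homomorphism $B\otimes\mathcal K\to C\otimes\mathcal K$ induces maps $KK(A,B)\to KK(A,C)$ and $E(A,B)\to E(A,C)$ by composition, and natural transformations are natural with respect to these maps. Let $p_{Bott}=\frac1{1+z\bar z}\begin{pmatrix} z\bar z& z\\ \bar z&1\end{pmatrix}\in C_0(\mathbb R^2)^+\otimes M_2$ (identifying $\mathbb R^2=\mathbb C$). $\beta^{\mathbb C}:C_0(\mathbb R^2)\otimes\mathcal K\to\mathcal K$ is the Bott asymptotic morphism; up to homotopy it is characterized by inducing on $K_0$ the isomorphism sending the generator $[\begin{pmatrix}1&0\\0&0\end{pmatrix}]-[p_{Bott}]$ of $K_0(C_0(\mathbb R^2))$ to $[1]\in K_0(\mathbb C)=K_0(\mathcal K)$. Put $\beta^A=\beta^{\mathbb C}\otimes\mathrm{id}_A\in E(A,A)$ and $\gamma^A=q(\mathrm{id}_A,0)\otimes\mathrm{id}_{\mathcal K}\in KK(A,A)$. By Connes–Higson there is a unique natural transformation $I_{A,-}:KK(A,-)\to E(A,-)$ with $I_{A,A}(\gamma^A)=\beta^A$. *)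

(* Defs.v *)
From HB Require Import structures.
From mathcomp Require Import all_boot all_order all_algebra generic_quotient.
From mathcomp Require Import complex.
From mathcomp Require Import all_classical all_reals.
From mathcomp Require Import interval_inference topology normedtype.
Set Implicit Arguments. Unset Strict Implicit. Unset Printing Implicit Defensive.
Import Order.TTheory GRing.Theory Num.Theory.
Import numFieldNormedType.Exports.
Local Open Scope classical_set_scope.
Local Open Scope ring_scope.
Local Open Scope quotient_scope.

HB.mixin Record isCStarAlgebra (R : realType) A
    & CompleteNormedModule R[i] A := {
  cmul : A -> A -> A;
  adj : A -> A;
  cmulA : associative cmul;
  cmulDl : left_distributive cmul +%R;
  cmulDr : right_distributive cmul +%R;
  cmulZl : forall (c : R[i]) x y, cmul (c *: x) y = c *: cmul x y;
  cmulZr : forall (c : R[i]) x y, cmul x (c *: y) = c *: cmul x y;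
  adjK : involutive adj;
  adjD : {morph adj : x y / x + y};
  adjZ : forall (c : R[i]) x, adj (c *: x) = c^* *: adj x;
  adjM : forall x y, adj (cmul x y) = cmul (adj y) (adj x);
  ler_norm_cmul : forall x y, `|cmul x y| <= `|x| * `|y|;
  cstar_identity : forall x, `|cmul (adj x) x| = `|x| ^+ 2
}.

#[short(type="cstarAlgType")]
HB.structure Definition CStarAlgebra (R : realType) :=
  {A of CompleteNormedModule R[i] A & isCStarAlgebra R A}.

Reserved Notation "x ** y" (at level 40, left associativity).
Notation "x ** y" := (cmul x y) : ring_scope.

Definition Cplx (R : realType) : Type := R[i].
HB.instance Definition _ (R : realType) := NormedModule.copy (Cplx R) R[i]^o.
Section Cplx.
Variable R : realType.

Lemma norm_Cplx (z : Cplx R) : `|z| = `|(z : R[i])|. Proof. by []. Qed.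

Lemma Cplx_complete (F : set_system (Cplx R)) :
  ProperFilter F -> cauchy F -> cvg F.
Proof.
move=> FF /cauchy_ballP Fc; apply/cvg_ex.
have ReN (z : Cplx R) : (`|complex.Re z|)%:C%C <= `|z| by exact: normc_ge_Re.
have ImN (z : Cplx R) : (`|complex.Im z|)%:C%C <= `|z|.
  rewrite (norm_Cplx z) normc_def lecR -sqrtr_sqr ler_sqrt ?addr_ge0 ?sqr_ge0//.
  by rewrite lerDr sqr_ge0.
have proj (g : Cplx R -> R) : (forall z, (`|g z|)%:C%C <= `|z|) ->
   (forall x y, g (x - y) = g x - g y) -> cvg (g @ F).
  move=> gN gB; apply: R_complete; apply/cauchy_ballP => e e0.
  have e0' : 0 < e%:C%C :> R[i] by rewrite ltcR.
  near_simpl.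
  have := Fc _ e0'; rewrite !near_map2.
  apply: filterS => -[x y] /=; rewrite -!ball_normE /= -gB => xy.
  by rewrite -ltcR; exact: le_lt_trans (gN _) xy.
have /cvg_ex[a Fa] : cvg (@complex.Re R @ F) by apply: proj => // -[? ?] [? ?].
have /cvg_ex[b Fb] : cvg (@complex.Im R @ F) by apply: proj => // -[? ?] [? ?].
exists (a +i* b)%C; apply/cvgrPdist_lt => -[e e'].
rewrite ltcE /= => /andP[/eqP-> e0].
move/cvgrPdist_lt : Fa => /(_ (e / 2)); rewrite divr_gt0// => /(_ isT) Fa.
move/cvgrPdist_lt : Fb => /(_ (e / 2)); rewrite divr_gt0// => /(_ isT) Fb.
have key (z : Cplx R) : `|a - complex.Re z| < e / 2 -> `|b - complex.Im z| < e / 2 ->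
    `|((a +i* b)%C : Cplx R) - z| < e%:C%C.
  case: z => x y /= za zb.
  have -> : (a +i* b)%C - (x +i* y)%C = (a - x)%:C%C + 'i%C * (b - y)%:C%C :> R[i].
    by apply/eqP; rewrite eq_complex/= !(mul0r,mul1r,add0r,addr0,subr0,mulr0,oppr0) !eqxx.
  rewrite (norm_Cplx _) (le_lt_trans (ler_normD _ _))// normrM.
  have -> : `|'i%C| = 1 :> R[i] by rewrite normc_def/= expr0n/= expr1n add0r sqrtr1.
  rewrite mul1r !normc_def /= expr0n /= !addr0 !sqrtr_sqr -rmorphD/= ltcR.
  by rewrite (splitr e) ltrD.
by near=> z; apply: key; near: z.
Unshelve. all: by end_near. Qed.
HB.instance Definition _ := Uniform_isComplete.Build (Cplx R) Cplx_complete.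
HB.instance Definition _ := CompleteNormedModule.on (Cplx R).

Definition mul_Cplx (x y : Cplx R) : Cplx R := (x : R[i]) * (y : R[i]).
Definition conj_Cplx (x : Cplx R) : Cplx R := ((x : R[i])^* : R[i]).

Fact mul_CplxA : associative mul_Cplx. Proof. exact: (@mulrA R[i]). Qed.
Fact mul_CplxDl : left_distributive mul_Cplx +%R.
Proof. exact: (@mulrDl R[i]). Qed.
Fact mul_CplxDr : right_distributive mul_Cplx +%R.
Proof. exact: (@mulrDr R[i]). Qed.
Fact mul_CplxZl (c : R[i]) x y : mul_Cplx (c *: x) y = c *: mul_Cplx x y.
Proof. by rewrite /mul_Cplx -[LHS]mulrA. Qed.
Fact mul_CplxZr (c : R[i]) x y : mul_Cplx x (c *: y) = c *: mul_Cplx x y.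
Proof. by rewrite /mul_Cplx -[RHS]mulrCA. Qed.
Fact conj_CplxK : involutive conj_Cplx. Proof. exact: (@conjCK R[i]). Qed.
Fact conj_CplxD : {morph conj_Cplx : x y / x + y}.
Proof. by move=> x y; exact: (rmorphD (@Num.conj R[i])). Qed.
Fact conj_CplxZ (c : R[i]) x : conj_Cplx (c *: x) = c^* *: conj_Cplx x.
Proof. exact: (rmorphM (@Num.conj R[i])). Qed.
Fact conj_CplxM x y :
  conj_Cplx (mul_Cplx x y) = mul_Cplx (conj_Cplx y) (conj_Cplx x).
Proof. by rewrite /mul_Cplx mulrC; exact: (rmorphM (@Num.conj R[i])). Qed.
Fact norm_mul_Cplx x y : `|mul_Cplx x y| <= `|x| * `|y|.
Proof. by rewrite !norm_Cplx normrM. Qed.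
Fact cstar_Cplx x : `|mul_Cplx (conj_Cplx x) x| = `|x| ^+ 2.
Proof. by rewrite !norm_Cplx normrM norm_conjC -expr2. Qed.

HB.instance Definition _ := isCStarAlgebra.Build R (Cplx R)
  mul_CplxA mul_CplxDl mul_CplxDr mul_CplxZl mul_CplxZr
  conj_CplxK conj_CplxD conj_CplxZ conj_CplxM norm_mul_Cplx cstar_Cplx.
End Cplx.
Section Basics.
Context {R : realType}.

Definition rnorm {A : cstarAlgType R} (x : A) : R := complex.Re `|x|.

Lemma rnormE {A : cstarAlgType R} (x : A) : (rnorm x)%:C%C = `|x|.
Proof. by apply: RRe_real; exact: ger0_real. Qed.

Lemma ReE (c : R[i]) : 0 <= c -> (complex.Re c)%:C%C = c.
Proof. by move=> c0; apply: RRe_real; exact: ger0_real. Qed.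

Lemma norm_adj (A : cstarAlgType R) (x : A) : `|adj x| = `|x|.
Proof.
have nle (y : A) : `|y| <= `|adj y|.
  have [->|y0] := eqVneq `|y| 0; first exact: normr_ge0.
  have yp : 0 < `|y| by rewrite lt_neqAle eq_sym y0 normr_ge0.
  rewrite -(ler_pM2r yp) -expr2 -cstar_identity; exact: ler_norm_cmul.
by apply/eqP; rewrite eq_le nle andbT -{2}(adjK x) nle.
Qed.

Lemma adj0 (A : cstarAlgType R) : adj 0 = 0 :> A.
Proof. by apply/eqP; rewrite -normr_eq0 norm_adj normr0. Qed.

Lemma adjN (A : cstarAlgType R) (x : A) : adj (- x) = - adj x.
Proof. by apply/eqP; rewrite -addr_eq0 -adjD addNr adj0. Qed.

Lemma adjB (A : cstarAlgType R) (x y : A) : adj (x - y) = adj x - adj y.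
Proof. by rewrite adjD adjN. Qed.

Lemma cmul0l (A : cstarAlgType R) (x : A) : 0 ** x = 0.
Proof. by have := cmulZl (0 : R[i]) (0 : A) x; rewrite !scale0r. Qed.

Lemma cmul0r (A : cstarAlgType R) (x : A) : x ** 0 = 0.
Proof. by have := cmulZr (0 : R[i]) x (0 : A); rewrite !scale0r. Qed.

Lemma cmulBl (A : cstarAlgType R) (x y z : A) : (x - y) ** z = x ** z - y ** z.
Proof. by rewrite cmulDl -(scaleN1r y) cmulZl scaleN1r. Qed.

Lemma cmulBr (A : cstarAlgType R) (x y z : A) : z ** (x - y) = z ** x - z ** y.
Proof. by rewrite cmulDr -(scaleN1r y) cmulZr scaleN1r. Qed.

Lemma adj_continuous (A : cstarAlgType R) : continuous (@adj R A).
Proof.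
move=> x; apply/cvgrPdist_lt => e e0; near=> y.
by rewrite -adjB norm_adj; near: y; exact: cvgr_dist_lt.
Unshelve. all: by end_near. Qed.

Lemma cmul_cvg (T : Type) (F : set_system T) (A : cstarAlgType R) (f g : T -> A) a b :
  Filter F -> f @ F --> a -> g @ F --> b -> (fun t => f t ** g t) @ F --> a ** b.
Proof.
move=> FF fa gb; apply/cvgrPdist_lt => e e0.
pose M : R[i] := `|a| + `|b| + 1 + 1.
have M1 : 1 <= M by rewrite lerDr addr_ge0// addr_ge0.
have M0 : 0 < M by exact: lt_le_trans M1.
have d0 : 0 < e / (M + M) by rewrite divr_gt0// addr_gt0.
near=> t.
have -> : a ** b - f t ** g t = (a - f t) ** b + f t ** (b - g t).
  by rewrite cmulBl cmulBr addrA subrK.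
rewrite (le_lt_trans (ler_normD _ _))//.
rewrite (@le_lt_trans _ _ (`|a - f t| * M + M * `|b - g t|))//.
  apply: lerD; apply: (le_trans (ler_norm_cmul _ _)).
    by rewrite ler_wpM2l// /M -!addrA addrCA lerDl !addr_ge0.
  rewrite ler_wpM2r// /M.
  have : `|a - f t| <= 1 by near: t; move/cvgrPdist_le : fa; apply.
  move=> af; rewrite -[f t](subKr a) (le_trans (ler_normB _ _))//.
  by rewrite -!addrA lerD2l// (le_trans af)// addrCA lerDl addr_ge0.
rewrite [ltRHS](_ : e = e / (M + M) * M + M * (e / (M + M))); last first.
  by rewrite [M * _]mulrC -mulrDr mulfVK// gt_eqF// addr_gt0.
rewrite ltrD//.
  by rewrite ltr_pM2r//; near: t; move/cvgrPdist_lt : fa; apply.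
by rewrite ltr_pM2l//; near: t; move/cvgrPdist_lt : gb; apply.
Unshelve. all: by end_near. Qed.

Lemma rnorm_continuous (A : cstarAlgType R) : continuous (@rnorm A).
Proof.
move=> x; apply/cvgrPdist_lt => e e0; near=> y.
have xy : `|x - y| < e%:C%C.
  by near: y; apply: cvgr_dist_lt; [exact: cvg_id | rewrite ltcR].
have : `| `|x| - `|y| | < e%:C%C by exact: le_lt_trans (ler_dist_dist _ _) xy.
rewrite -(rnormE x) -(rnormE y) -rmorphB/= normc_def/= expr0n/= addr0 sqrtr_sqr.
by rewrite ltcR.
Unshelve. all: by end_near. Qed.

Definition separable (T : topologicalType) :=
  exists2 D : set T, countable D & dense D.

End Basics.

Definition closed_subalgebra (R : realType) (A : cstarAlgType R) (S : set A) :=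
  [/\ closed S, S 0, forall (c : R[i]) x y, S x -> S y -> S (c *: x + y),
      forall x y, S x -> S y -> S (x ** y) & forall x, S x -> S (adj x)].

Definition subalg (R : realType) (A : cstarAlgType R) (S : set A)
  (hS : closed_subalgebra S) : Type := {x : A | S x}.

Section SubAlgebra.
Variables (R : realType) (A : cstarAlgType R) (S : set A).
Variable hS : closed_subalgebra S.
Local Notation T := (subalg hS).
Local Notation val := (@proj1_sig A S).

HB.instance Definition _ := gen_eqMixin T.
HB.instance Definition _ := gen_choiceMixin T.

Lemma sub_inj (x y : T) : val x = val y -> x = y.
Proof. exact: eq_sig_hprop. Qed.

Let S0 : S 0. Proof. by case: hS. Qed.
Let SP (c : R[i]) x y : S x -> S y -> S (c *: x + y). Proof. by case: hS => _ _ + _ _; exact. Qed.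
Let SD x y : S x -> S y -> S (x + y).
Proof. by move=> Sx Sy; rewrite -(scale1r x); exact: SP. Qed.
Let SZ (c : R[i]) x : S x -> S (c *: x).
Proof. by move=> Sx; rewrite -[_ *: _]addr0; exact: SP. Qed.
Let SN x : S x -> S (- x). Proof. by rewrite -scaleN1r; exact: SZ. Qed.
Let SM x y : S x -> S y -> S (x ** y). Proof. by case: hS => _ _ _ + _; exact. Qed.
Let SJ x : S x -> S (adj x). Proof. by case: hS => _ _ _ _; exact. Qed.

Definition sub_add (x y : T) : T := exist _ _ (SD (proj2_sig x) (proj2_sig y)).
Definition sub_opp (x : T) : T := exist _ _ (SN (proj2_sig x)).
Definition sub_scale (c : R[i]) (x : T) : T := exist _ _ (SZ c (proj2_sig x)).
Definition sub_mul (x y : T) : T := exist _ _ (SM (proj2_sig x) (proj2_sig y)).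
Definition sub_adj (x : T) : T := exist _ _ (SJ (proj2_sig x)).

Fact sub_addA : associative sub_add.
Proof. by move=> x y z; apply: sub_inj; exact: addrA. Qed.
Fact sub_addC : commutative sub_add.
Proof. by move=> x y; apply: sub_inj; exact: addrC. Qed.
Fact sub_add0 : left_id (exist _ 0 S0 : T) sub_add.
Proof. by move=> x; apply: sub_inj; exact: add0r. Qed.
Fact sub_addN : left_inverse (exist _ 0 S0 : T) sub_opp sub_add.
Proof. by move=> x; apply: sub_inj; exact: addNr. Qed.
HB.instance Definition _ :=
  GRing.isZmodule.Build T sub_addA sub_addC sub_add0 sub_addN.

Fact sub_scaleA (a b : R[i]) (v : T) :
  sub_scale a (sub_scale b v) = sub_scale (a * b) v.
Proof. by apply: sub_inj; exact: scalerA. Qed.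
Fact sub_scale1 : left_id 1 sub_scale.
Proof. by move=> x; apply: sub_inj; exact: scale1r. Qed.
Fact sub_scaleDr : right_distributive sub_scale +%R.
Proof. by move=> a x y; apply: sub_inj; exact: scalerDr. Qed.
Fact sub_scaleDl (v : T) : {morph sub_scale^~ v : a b / a + b}.
Proof. by move=> a b; apply: sub_inj; exact: scalerDl. Qed.
HB.instance Definition _ := GRing.Zmodule_isLmodule.Build R[i] T
  sub_scaleA sub_scale1 sub_scaleDr sub_scaleDl.

Fact sub_normD (x y : T) : `|val (x + y)| <= `|val x| + `|val y|.
Proof. exact: ler_normD. Qed.
Fact sub_normZ (c : R[i]) (x : T) : `|val (c *: x)| = `|c| * `|val x|.
Proof. exact: normrZ. Qed.
Fact sub_norm0 (x : T) : `|val x| = 0 -> x = 0.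
Proof. by move/normr0_eq0 => x0; exact: sub_inj. Qed.
HB.instance Definition _ := Lmodule_isNormed.Build R[i] T
  sub_normD sub_normZ sub_norm0.

Fact sub_complete (F : set_system T) : ProperFilter F -> cauchy F -> cvg F.
Proof.
move=> FF /cauchy_ballP Fc; apply/cvg_ex.
have : cvg (val @ F).
  apply: cauchy_cvg; apply/cauchy_ballP => e e0; near_simpl.
  by have := Fc _ e0; rewrite !near_map2; apply: filterS => -[x y] /=; rewrite -!ball_normE.
move/cvg_ex => [a Fa].
have Sa : S a.
  have Scl : closed S by case: hS.
  apply: (@closed_cvg _ _ F FF val S Scl _ a Fa).
  by apply: nearW => x; exact: (proj2_sig x).
exists (exist _ a Sa : T); apply/cvgrPdist_lt => e e0.
by move/cvgrPdist_lt : Fa; apply.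
Qed.
HB.instance Definition _ := Uniform_isComplete.Build T sub_complete.

Fact sub_mulA : associative sub_mul.
Proof. by move=> x y z; apply: sub_inj; exact: cmulA. Qed.
Fact sub_mulDl : left_distributive sub_mul +%R.
Proof. by move=> x y z; apply: sub_inj; exact: cmulDl. Qed.
Fact sub_mulDr : right_distributive sub_mul +%R.
Proof. by move=> x y z; apply: sub_inj; exact: cmulDr. Qed.
Fact sub_mulZl (c : R[i]) x y : sub_mul (c *: x) y = c *: sub_mul x y.
Proof. by apply: sub_inj; exact: cmulZl. Qed.
Fact sub_mulZr (c : R[i]) x y : sub_mul x (c *: y) = c *: sub_mul x y.
Proof. by apply: sub_inj; exact: cmulZr. Qed.
Fact sub_adjK : involutive sub_adj.
Proof. by move=> x; apply: sub_inj; exact: adjK. Qed.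
Fact sub_adjD : {morph sub_adj : x y / x + y}.
Proof. by move=> x y; apply: sub_inj; exact: adjD. Qed.
Fact sub_adjZ (c : R[i]) x : sub_adj (c *: x) = c^* *: sub_adj x.
Proof. by apply: sub_inj; exact: adjZ. Qed.
Fact sub_adjM x y : sub_adj (sub_mul x y) = sub_mul (sub_adj y) (sub_adj x).
Proof. by apply: sub_inj; exact: adjM. Qed.
Fact sub_normM (x y : T) : `|sub_mul x y| <= `|x| * `|y|.
Proof. exact: ler_norm_cmul. Qed.
Fact sub_cstar (x : T) : `|sub_mul (sub_adj x) x| = `|x| ^+ 2.
Proof. exact: cstar_identity. Qed.
HB.instance Definition _ := isCStarAlgebra.Build R T
  sub_mulA sub_mulDl sub_mulDr sub_mulZl sub_mulZr
  sub_adjK sub_adjD sub_adjZ sub_adjM sub_normM sub_cstar.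
End SubAlgebra.

Definition vanishes_at_infinity (R : realType) (X : topologicalType)
    (B : cstarAlgType R) (f : X -> B) :=
  forall e : R[i], 0 < e ->
    exists2 C : set X, compact C & forall x, ~ C x -> `|f x| < e.

Record C0 (R : realType) (X : topologicalType) (B : cstarAlgType R) := MkC0 {
  c0_fun :> X -> B;
  c0_cont : continuous c0_fun;
  c0_vanish : vanishes_at_infinity c0_fun
}.

Arguments c0_cont {R X B} _ _ [_] _.

Lemma vanish_dom (R : realType) (X : topologicalType) (B C : cstarAlgType R)
    (h : X -> C) (f : X -> B) (M : R[i]) : 0 <= M -> vanishes_at_infinity f ->
  (forall x, `|h x| <= M * `|f x|) -> vanishes_at_infinity h.
Proof.
move=> M0 fv hf e e0.
have M1 : 0 < M + 1 by rewrite ltr_wpDl.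
have [|D cD fD] := fv (e / (M + 1)); first by rewrite divr_gt0.
exists D => // x /fD fx; apply: le_lt_trans (hf x) _.
rewrite (@le_lt_trans _ _ ((M + 1) * `|f x|))//.
  by rewrite ler_wpM2r// lerDl.
by rewrite mulrC -ltr_pdivlMr.
Qed.

Section C0.
Variables (R : realType) (X : topologicalType) (B : cstarAlgType R).
Local Notation T := (C0 X B).
Implicit Types f g : T.

HB.instance Definition _ := gen_eqMixin T.
HB.instance Definition _ := gen_choiceMixin T.

Lemma c0_eq f g : (forall x, f x = g x) -> f = g.
Proof.
case: f g => [f f1 f2] [g g1 g2] /= /funext fg; subst g.
by congr MkC0; exact: Prop_irrelevance.
Qed.

Lemma vanish_add f g : vanishes_at_infinity (fun x => f x + g x).
Proof.
move=> e e0; have e2 : 0 < e / 2 by rewrite divr_gt0.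
have [C cC fC] := c0_vanish f e2; have [D cD gD] := c0_vanish g e2.
exists (C `|` D); first exact: compactU.
move=> x /not_orP[/fC fx /gD gx]; rewrite (le_lt_trans (ler_normD _ _))//.
by rewrite (splitr e) ltrD.
Qed.

Lemma c0_bounded f : has_ubound (range (fun x => rnorm (f x))).
Proof.
have [C cC fC] := c0_vanish f (e := 1) ltr01.
have nc : continuous (fun x => rnorm (f x)).
  move=> x; apply: (@continuous_comp _ _ _ f (@rnorm R B)).
    exact: c0_cont.
  exact: rnorm_continuous.
have : compact ((fun x => rnorm (f x)) @` C).
  by apply: continuous_compact => //; exact: continuous_subspaceT.
move/compact_bounded => -[M [_ /(_ (M + 1))]].
rewrite ltrDl ltr01 => /(_ isT) CM.
exists (Num.max 1 (M + 1)) => _ [x _ <-].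
have [Cx|nCx] := pselect (C x).
  rewrite le_max; apply/orP; right.
  by apply: le_trans (ler_norm _) _; apply: CM; exists x.
by rewrite le_max -lecR rnormE (ltW (fC _ nCx)).
Qed.

Definition c0_norm f : R[i] := (sup (range (fun x => rnorm (f x))))%:C%C.

Lemma le_c0_norm f x : `|f x| <= c0_norm f.
Proof. by rewrite -rnormE lecR; apply: (ub_le_sup (c0_bounded f)); exists x. Qed.

Lemma c0_norm_ge0 f : 0 <= c0_norm f.
Proof.
have [[x _]|X0] := pselect ([set: X] !=set0).
  exact: le_trans (le_c0_norm f x).
suff rf0 : range (fun x => rnorm (f x)) = set0 by rewrite /c0_norm rf0 sup0.
by rewrite -subset0 => y [x _ _]; apply: X0; exists x.
Qed.

Lemma c0_norm_le f (c : R[i]) : 0 <= c -> (forall x, `|f x| <= c) ->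
  c0_norm f <= c.
Proof.
move=> c0 fc.
have [[x _]|X0] := pselect ([set: X] !=set0).
  rewrite -(ReE c0) lecR; apply: ge_sup; first by exists (rnorm (f x)), x.
  by move=> _ [y _ <-]; rewrite -lecR rnormE ReE.
suff rf0 : range (fun x => rnorm (f x)) = set0 by rewrite /c0_norm rf0 sup0.
by rewrite -subset0 => y [x _ _]; apply: X0; exists x.
Qed.

Lemma const0_vanish : vanishes_at_infinity (fun _ : X => 0 : B).
Proof. by move=> e e0; exists set0 => [|x _]; [exact: compact0|rewrite normr0]. Qed.

Definition c0_zero : T := MkC0 (fun x => cvg_cst 0) const0_vanish.
Definition c0_add f g : T :=
  MkC0 (fun x => cvgD (c0_cont f x) (c0_cont g x)) (vanish_add f g).
Fact c0_opp_vanish f : vanishes_at_infinity (fun x => - f x).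
Proof. by apply: (@vanish_dom _ _ _ _ _ f 1) => [//||x]; [exact: c0_vanish|]; rewrite normrN mul1r. Qed.
Definition c0_opp f : T := MkC0 (fun x => cvgN (c0_cont f x)) (c0_opp_vanish f).
Fact c0_scale_vanish (c : R[i]) f : vanishes_at_infinity (fun x => c *: f x).
Proof. by apply: (@vanish_dom _ _ _ _ _ f `|c|) => [//||x]; [exact: c0_vanish|]; rewrite normrZ. Qed.
Fact c0_scale_cont (c : R[i]) f : continuous (fun x => c *: f x).
Proof. by move=> x; apply: cvgZ; [exact: cvg_cst|exact: c0_cont]. Qed.
Definition c0_scale (c : R[i]) f : T :=
  MkC0 (@c0_scale_cont c f) (c0_scale_vanish c f).
Fact c0_mul_vanish f g : vanishes_at_infinity (fun x => f x ** g x).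
Proof.
apply: (@vanish_dom _ _ _ _ _ g (c0_norm f)) => [||x].
- exact: c0_norm_ge0.
- exact: c0_vanish.
apply: (le_trans (ler_norm_cmul _ _)).
by rewrite ler_wpM2r// le_c0_norm.
Qed.
Definition c0_mul f g : T :=
  MkC0 (fun x => cmul_cvg _ (c0_cont f x) (c0_cont g x)) (c0_mul_vanish f g).
Fact c0_adj_cont f : continuous (fun x => adj (f x)).
Proof.
move=> x; apply: (@continuous_comp _ _ _ f (@adj R B)); first exact: c0_cont.
exact: adj_continuous.
Qed.
Fact c0_adj_vanish f : vanishes_at_infinity (fun x => adj (f x)).
Proof. by apply: (@vanish_dom _ _ _ _ _ f 1) => [//||x]; [exact: c0_vanish|]; rewrite norm_adj mul1r. Qed.
Definition c0_adj f : T := MkC0 (@c0_adj_cont f) (c0_adj_vanish f).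

Fact c0_addA : associative c0_add.
Proof. by move=> f g h; apply: c0_eq => x; exact: addrA. Qed.
Fact c0_addC : commutative c0_add.
Proof. by move=> f g; apply: c0_eq => x; exact: addrC. Qed.
Fact c0_add0 : left_id c0_zero c0_add.
Proof. by move=> f; apply: c0_eq => x; exact: add0r. Qed.
Fact c0_addN : left_inverse c0_zero c0_opp c0_add.
Proof. by move=> f; apply: c0_eq => x; exact: addNr. Qed.
HB.instance Definition _ :=
  GRing.isZmodule.Build T c0_addA c0_addC c0_add0 c0_addN.

Fact c0_scaleA (a b : R[i]) f : c0_scale a (c0_scale b f) = c0_scale (a * b) f.
Proof. by apply: c0_eq => x; exact: scalerA. Qed.
Fact c0_scale1 : left_id 1 c0_scale.
Proof. by move=> f; apply: c0_eq => x; exact: scale1r. Qed.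
Fact c0_scaleDr : right_distributive c0_scale +%R.
Proof. by move=> a f g; apply: c0_eq => x; exact: scalerDr. Qed.
Fact c0_scaleDl f : {morph c0_scale^~ f : a b / a + b}.
Proof. by move=> a b; apply: c0_eq => x; exact: scalerDl. Qed.
HB.instance Definition _ := GRing.Zmodule_isLmodule.Build R[i] T
  c0_scaleA c0_scale1 c0_scaleDr c0_scaleDl.

Fact c0_normD f g : c0_norm (f + g) <= c0_norm f + c0_norm g.
Proof.
apply: c0_norm_le => [|x]; first by rewrite addr_ge0// c0_norm_ge0.
by rewrite (le_trans (ler_normD _ _))// lerD// le_c0_norm.
Qed.
Fact c0_normZ (c : R[i]) f : c0_norm (c *: f) = `|c| * c0_norm f.
Proof.
have le (a : R[i]) g : c0_norm (a *: g) <= `|a| * c0_norm g.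
  apply: c0_norm_le => [|x]; first by rewrite mulr_ge0// c0_norm_ge0.
  by rewrite normrZ ler_wpM2l// le_c0_norm.
apply/eqP; rewrite eq_le le /=.
have [->|c0] := eqVneq c 0; first by rewrite normr0 mul0r c0_norm_ge0.
rewrite -{1}(scale1r f) -(mulVf c0) -scalerA.
rewrite (le_trans (ler_wpM2l _ (le _ _)))// mulrA -normrM divff// normr1.
by rewrite mul1r.
Qed.
Fact c0_norm0 f : c0_norm f = 0 -> f = 0.
Proof.
move=> f0; apply: c0_eq => x; apply/eqP.
by rewrite -normr_le0 -f0 le_c0_norm.
Qed.
HB.instance Definition _ := Lmodule_isNormed.Build R[i] T
  c0_normD c0_normZ c0_norm0.

Lemma norm_c0_le f (c : R[i]) : 0 <= c -> (forall x, `|f x| <= c) -> `|f| <= c.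
Proof. exact: c0_norm_le. Qed.

Lemma le_norm_c0 f x : `|f x| <= `|f|.
Proof. exact: le_c0_norm. Qed.

Fact c0_complete (F : set_system T) : ProperFilter F -> cauchy F -> cvg F.
Proof.
move=> FF Fc; apply/cvg_ex.
have evc x : cvg ((fun f : T => f x) @ F).
  apply: cauchy_cvg; apply/cauchy_ballP => e e0; near_simpl.
  move/cauchy_ballP : Fc => /(_ _ e0); rewrite !near_map2.
  apply: filterS => -[f g] /=; rewrite -!ball_normE /=.
  exact: le_lt_trans (le_c0_norm (f - g) x).
pose g x := lim ((fun f : T => f x) @ F).
have key (e : R[i]) : 0 < e -> exists2 f0 : T,
    (\forall f \near F, `|f0 - f| < e) & forall x, `|f0 x - g x| <= e.
  move=> e0; have /cauchyP/(_ _ e0)[f0 Ff0] := Fc.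
  have Ff : \forall f \near F, `|f0 - f| < e.
    by apply: filterS Ff0 => f; rewrite -ball_normE.
  exists f0 => // x.
  rewrite -rnormE -(ReE (ltW e0)) lecR.
  apply: (@cvgr_to_le _ F FF R (fun f : T => rnorm (f0 x - f x))).
    apply: continuous_cvg; first exact: rnorm_continuous.
    by apply: cvgB; [exact: cvg_cst|exact: evc].
  apply: filterS Ff => f f0f.
  rewrite -lecR rnormE (ReE (ltW e0)).
  exact: le_trans (le_c0_norm (f0 - f) x) (ltW f0f).
have gc : continuous g.
  move=> x; apply/cvgrPdist_lt => e e0.
  have e3 : 0 < e / 3 by rewrite divr_gt0.
  have [f0 _ f0g] := key _ e3.
  near=> y.
  rewrite (_ : g x - g y = (g x - f0 x) + (f0 x - f0 y) + (f0 y - g y)); last first.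
    by rewrite !addrA !subrK.
  rewrite (le_lt_trans (ler_normD _ _))//.
  rewrite (_ : e = e / 3 + e / 3 + e / 3); last first.
    by rewrite -mulr2n -mulrSr -[_ / _ *+ _]mulr_natr divfK// pnatr_eq0.
  apply: ltr_leD; last exact: f0g.
  rewrite (le_lt_trans (ler_normD _ _))//; apply: ler_ltD.
    by rewrite distrC; exact: f0g.
  near: y; have /cvgrPdist_lt := c0_cont f0 x; exact.
have gv : vanishes_at_infinity g.
  move=> e e0; have e2 : 0 < e / 2 by rewrite divr_gt0.
  have [f0 _ f0g] := key _ e2.
  have [C cC f0C] := c0_vanish f0 e2; exists C => // x /f0C f0x.
  rewrite -(subrK (f0 x) (g x)) (le_lt_trans (ler_normD _ _))//.
  by rewrite (splitr e) ler_ltD// distrC.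
exists (MkC0 gc gv); apply/cvgrPdist_le => e e0.
have e2 : 0 < e / 2 by rewrite divr_gt0.
have [f0 Ff0 f0g] := key _ e2.
apply: filterS Ff0 => f f0f.
rewrite -(subrK f0 (MkC0 gc gv)) -addrA (le_trans (ler_normD _ _))//.
rewrite (splitr e) lerD//; last exact: ltW.
by apply: norm_c0_le => [|x]; [exact: ltW|rewrite distrC; exact: f0g].
Unshelve. all: by end_near. Qed.
HB.instance Definition _ := Uniform_isComplete.Build T c0_complete.

Fact c0_mulA : associative c0_mul.
Proof. by move=> f g h; apply: c0_eq => x; exact: cmulA. Qed.
Fact c0_mulDl : left_distributive c0_mul +%R.
Proof. by move=> f g h; apply: c0_eq => x; exact: cmulDl. Qed.
Fact c0_mulDr : right_distributive c0_mul +%R.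
Proof. by move=> f g h; apply: c0_eq => x; exact: cmulDr. Qed.
Fact c0_mulZl (c : R[i]) f g : c0_mul (c *: f) g = c *: c0_mul f g.
Proof. by apply: c0_eq => x; exact: cmulZl. Qed.
Fact c0_mulZr (c : R[i]) f g : c0_mul f (c *: g) = c *: c0_mul f g.
Proof. by apply: c0_eq => x; exact: cmulZr. Qed.
Fact c0_adjK : involutive c0_adj.
Proof. by move=> f; apply: c0_eq => x; exact: adjK. Qed.
Fact c0_adjD : {morph c0_adj : f g / f + g}.
Proof. by move=> f g; apply: c0_eq => x; exact: adjD. Qed.
Fact c0_adjZ (c : R[i]) f : c0_adj (c *: f) = c^* *: c0_adj f.
Proof. by apply: c0_eq => x; exact: adjZ. Qed.
Fact c0_adjM f g : c0_adj (c0_mul f g) = c0_mul (c0_adj g) (c0_adj f).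
Proof. by apply: c0_eq => x; exact: adjM. Qed.
Fact c0_normM f g : `|c0_mul f g| <= `|f| * `|g|.
Proof.
apply: norm_c0_le => [|x]; first by rewrite mulr_ge0.
by rewrite (le_trans (ler_norm_cmul _ _))// ler_pM// le_norm_c0.
Qed.
Fact c0_cstar f : `|c0_mul (c0_adj f) f| = `|f| ^+ 2.
Proof.
apply/eqP; rewrite eq_le; apply/andP; split.
  apply: norm_c0_le => [|x]; first by rewrite exprn_ge0.
  by rewrite /= cstar_identity lerXn2r ?nnegrE// le_norm_c0.
pose N := complex.Re `|c0_mul (c0_adj f) f|.
have NE : N%:C%C = `|c0_mul (c0_adj f) f| by rewrite ReE.
have h : `|f| <= (Num.sqrt N)%:C%C.
  apply: norm_c0_le => [|x]; first by rewrite ler0c sqrtr_ge0.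
  rewrite -(rnormE (f x)) lecR.
  have n0 : 0 <= rnorm (f x) by rewrite -ler0c rnormE.
  rewrite -(ger0_norm n0) -sqrtr_sqr ler_wsqrtr// -lecR rmorphXn/= rnormE NE.
  by rewrite -cstar_identity; exact: (le_norm_c0 (c0_mul (c0_adj f) f)).
have N0 : 0 <= N by rewrite -ler0c NE.
have s0 : 0 <= (Num.sqrt N)%:C%C by rewrite ler0c sqrtr_ge0.
by rewrite -NE -(sqr_sqrtr N0) rmorphXn/= lerXn2r ?nnegrE.
Qed.
HB.instance Definition _ := isCStarAlgebra.Build R T
  c0_mulA c0_mulDl c0_mulDr c0_mulZl c0_mulZr
  c0_adjK c0_adjD c0_adjZ c0_adjM c0_normM c0_cstar.
End C0.

Record starHom (R : realType) (A B : cstarAlgType R) := MkStarHom {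
  sh_fun :> A -> B;
  sh_linear : forall (c : R[i]) x y, sh_fun (c *: x + y) = c *: sh_fun x + sh_fun y;
  sh_mul : {morph sh_fun : x y / x ** y};
  sh_adj : {morph sh_fun : x / adj x};
  sh_le : forall x, `|sh_fun x| <= `|x|
}.

Record asympMor (R : realType) (A B : cstarAlgType R) := MkAsympMor {
  am_fun :> R -> A -> B;
  am_cont : forall a, {within `[0, +oo[, continuous (fun t => am_fun t a)};
  am_adj : forall a, am_fun t (adj a) - adj (am_fun t a) @[t --> +oo] --> (0 : B);
  am_linear : forall a (c : R[i]) b,
    am_fun t (a + c *: b) - am_fun t a - c *: am_fun t b @[t --> +oo] --> (0 : B);
  am_mul : forall a b,
    am_fun t (a ** b) - am_fun t a ** am_fun t b @[t --> +oo] --> (0 : B)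
}.

Section StarHom.
Context {R : realType}.
Implicit Types A B C : cstarAlgType R.

HB.instance Definition _ A B := gen_eqMixin (starHom A B).
HB.instance Definition _ A B := gen_choiceMixin (starHom A B).
HB.instance Definition _ A B := gen_eqMixin (asympMor A B).
HB.instance Definition _ A B := gen_choiceMixin (asympMor A B).

Lemma sh_eq A B (f g : starHom A B) : (forall x, f x = g x) -> f = g.
Proof.
case: f g => [f f1 f2 f3 f4] [g g1 g2 g3 g4] /= /funext fg; subst g.
by congr MkStarHom; exact: Prop_irrelevance.
Qed.

Lemma sh0 A B (f : starHom A B) : f 0 = 0.
Proof. by have := sh_linear f (-1) 0 0; rewrite scaler0 add0r scaleN1r addNr. Qed.
Lemma shD A B (f : starHom A B) : {morph f : x y / x + y}.
Proof. by move=> x y; have := sh_linear f 1 x y; rewrite !scale1r. Qed.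
Lemma shZ A B (f : starHom A B) (c : R[i]) x : f (c *: x) = c *: f x.
Proof. by have := sh_linear f c x 0; rewrite sh0 !addr0. Qed.
Lemma shN A B (f : starHom A B) : {morph f : x / - x}.
Proof. by move=> x; rewrite -scaleN1r shZ scaleN1r. Qed.
Lemma shB A B (f : starHom A B) : {morph f : x y / x - y}.
Proof. by move=> x y; rewrite shD shN. Qed.

Lemma sh_continuous A B (f : starHom A B) : continuous f.
Proof.
move=> x; apply/cvgrPdist_lt => e e0; near=> y.
rewrite -shB; apply: le_lt_trans (sh_le _ _) _.
by near: y; exact: cvgr_dist_lt.
Unshelve. all: by end_near. Qed.

Fact id_le A (x : A) : `|id x| <= `|x|. Proof. by []. Qed.
Definition sh_id A : starHom A A :=
  MkStarHom (fun c x y => erefl) (fun x y => erefl) (fun x => erefl) (@id_le A).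

Section Comp.
Variables (A B C : cstarAlgType R) (g : starHom B C) (f : starHom A B).
Fact comp_linear (c : R[i]) x y : (g \o f) (c *: x + y) = c *: (g \o f) x + (g \o f) y.
Proof. by rewrite /= !sh_linear. Qed.
Fact comp_mul : {morph g \o f : x y / x ** y}.
Proof. by move=> x y; rewrite /= !sh_mul. Qed.
Fact comp_adj : {morph g \o f : x / adj x}.
Proof. by move=> x; rewrite /= !sh_adj. Qed.
Fact comp_le x : `|(g \o f) x| <= `|x|.
Proof. by rewrite /= (le_trans (sh_le _ _))// sh_le. Qed.
Definition sh_comp := MkStarHom comp_linear comp_mul comp_adj comp_le.
End Comp.

Section Zero.
Variables (A B : cstarAlgType R).
Let z : A -> B := fun=> 0.
Fact zero_linear (c : R[i]) x y : z (c *: x + y) = c *: z x + z y.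
Proof. by rewrite /z scaler0 addr0. Qed.
Fact zero_mul : {morph z : x y / x ** y}.
Proof. by move=> x y; rewrite /z cmul0l. Qed.
Fact zero_adj : {morph z : x / adj x}.
Proof. by move=> x; rewrite /z adj0. Qed.
Fact zero_le x : `|z x| <= `|x|. Proof. by rewrite normr0. Qed.
Definition sh_zero := MkStarHom zero_linear zero_mul zero_adj zero_le.
End Zero.

Section Ev.
Variables (X : topologicalType) (B : cstarAlgType R) (x : X).
Definition sh_ev : starHom (C0 X B) B :=
  @MkStarHom R (C0 X B) B (fun f => f x) (fun c f g => erefl)
    (fun f g => erefl) (fun f => erefl) (fun f => le_norm_c0 f x).
End Ev.

Section Post.
Variables (X : topologicalType) (B C : cstarAlgType R) (phi : starHom B C).
Fact post_cont (f : C0 X B) : continuous (phi \o f).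
Proof. by move=> x; apply: continuous_comp; [exact: c0_cont|exact: sh_continuous]. Qed.
Fact post_vanish (f : C0 X B) : vanishes_at_infinity (phi \o f).
Proof.
apply: (@vanish_dom _ _ _ _ _ f 1) => [//||x]; first exact: c0_vanish.
by rewrite mul1r sh_le.
Qed.
Definition c0_post (f : C0 X B) : C0 X C := MkC0 (@post_cont f) (post_vanish f).
Fact post_linear (c : R[i]) f g :
  c0_post (c *: f + g) = c *: c0_post f + c0_post g.
Proof. by apply: c0_eq => x; exact: sh_linear. Qed.
Fact post_mul : {morph c0_post : f g / f ** g}.
Proof. by move=> f g; apply: c0_eq => x; exact: sh_mul. Qed.
Fact post_adj : {morph c0_post : f / adj f}.
Proof. by move=> f; apply: c0_eq => x; exact: sh_adj. Qed.
Fact post_le f : `|c0_post f| <= `|f|.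
Proof.
by apply: norm_c0_le => // x; rewrite (le_trans (sh_le _ _))// le_norm_c0.
Qed.
Definition sh_post : starHom (C0 X B) (C0 X C) :=
  MkStarHom post_linear post_mul post_adj post_le.
End Post.

Lemma as_squeeze A B C (u : R -> A) (v : R -> B) (w : R -> C) :
  (forall t, 0 <= t -> `|w t| <= `|u t| + `|v t|) ->
  u t @[t --> +oo] --> (0 : A) -> v t @[t --> +oo] --> (0 : B) ->
  w t @[t --> +oo] --> (0 : C).
Proof.
move=> wuv u0 v0; apply/cvgr0Pnorm_lt => e e0.
have e2 : 0 < e / 2 by rewrite divr_gt0.
move/cvgr0Pnorm_lt : u0 => /(_ _ e2) u0.
move/cvgr0Pnorm_lt : v0 => /(_ _ e2) v0.
near=> t.
rewrite (le_lt_trans (wuv _ _))// (splitr e) ltrD//; first by near: t.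
by near: t.
Unshelve. all: by end_near. Qed.

Section PostAsymp.
Variables (A B C : cstarAlgType R) (g : starHom B C) (f : asympMor A B).
Let h (t : R) (a : A) : C := g (f t a).
Fact am_post_cont a : {within `[0, +oo[, continuous (fun t => h t a)}.
Proof.
move=> t; apply: (@continuous_comp (subspace _) _ _ (fun t => f t a) g).
  exact: am_cont.
exact: sh_continuous.
Qed.
Fact am_post_le (u : R -> B) : u t @[t --> +oo] --> (0 : B) ->
  g (u t) @[t --> +oo] --> (0 : C).
Proof.
by move=> u0; rewrite -(sh0 g); apply: continuous_cvg => //; exact: sh_continuous.
Qed.
Fact am_post_adj a : h t (adj a) - adj (h t a) @[t --> +oo] --> (0 : C).
Proof.
have := am_post_le (am_adj f a); apply: cvg_trans; apply: near_eq_cvg.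
by apply: nearW => t; rewrite shB sh_adj.
Qed.
Fact am_post_linear a (c : R[i]) b :
  h t (a + c *: b) - h t a - c *: h t b @[t --> +oo] --> (0 : C).
Proof.
have := am_post_le (am_linear f a c b); apply: cvg_trans; apply: near_eq_cvg.
by apply: nearW => t; rewrite !shB shZ.
Qed.
Fact am_post_mul a b : h t (a ** b) - h t a ** h t b @[t --> +oo] --> (0 : C).
Proof.
have := am_post_le (am_mul f a b); apply: cvg_trans; apply: near_eq_cvg.
by apply: nearW => t; rewrite shB sh_mul.
Qed.
Definition am_post : asympMor A C :=
  MkAsympMor am_post_cont am_post_adj am_post_linear am_post_mul.
End PostAsymp.

End StarHom.

Definition unitI (R : realType) : topologicalType := set_type `[0%R : R, 1].

Section UnitInterval.
Context {R : realType}.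
Local Notation I := (unitI R).
Implicit Types A B C : cstarAlgType R.

Fact clamp_subproof (s : R) : Num.max 0 (Num.min 1 s) \in `[0%R : R, 1]%classic.
Proof.
by rewrite inE /= in_itv /= le_max lexx /= ge_max ler01 ge_min lexx.
Qed.
Definition clamp (s : R) : I := exist (fun s => s \in `[0%R : R, 1]%classic) _ (clamp_subproof s).
Definition I0 : I := clamp 0.
Definition I1 : I := clamp 1.

Definition ival (s : I) : R := @set_val R `[0%R : R, 1]%classic s.

Lemma ivalE (s : R) : ival (clamp s) = Num.max 0 (Num.min 1 s).
Proof. by rewrite /ival (@set_valE R `[0%R : R, 1]%classic). Qed.

Lemma ival_inj (s u : I) : ival s = ival u -> s = u.
Proof.
by rewrite /ival (@set_valE R `[0%R : R, 1]%classic) => su; exact: val_inj.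
Qed.

Lemma ivalP (s : I) : `[0%R : R, 1]%classic (ival s).
Proof. exact: (@set_valP R `[0%R : R, 1]%classic). Qed.

Lemma clamp_id (s : I) : clamp (ival s) = s.
Proof.
apply: ival_inj; rewrite ivalE.
by have := ivalP s; rewrite /= in_itv /= => /andP[s0 s1]; rewrite min_r// max_r.
Qed.

Lemma clamp_continuous : continuous clamp.
Proof.
apply: (@continuous_comp_initial _ _ _ (@set_val R `[0%R : R, 1]%classic)).
have -> : @set_val R `[0%R : R, 1]%classic \o clamp = fun s => Num.max 0 (Num.min 1 s).
  by apply/funext => s; exact: ivalE.
move=> s.
apply: (@continuous_max R R (cst 0) (fun s => Num.min 1 s)); first exact: cvg_cst.
apply: (@continuous_min R R (cst 1) id); first exact: cvg_cst.
exact: cvg_id.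
Qed.

Lemma ival_continuous : continuous ival.
Proof. by move=> s; exact: initial_continuous. Qed.

Lemma unitI_compact : compact [set: I].
Proof.
have -> : [set: I] = clamp @` `[0, 1]%classic.
  apply/seteqP; split=> // s _; exists (ival s); last exact: clamp_id.
  exact: ivalP.
apply: continuous_compact; last exact: segment_compact.
by apply: continuous_subspaceT; exact: clamp_continuous.
Qed.

Lemma CI_vanish B (f : I -> B) : vanishes_at_infinity f.
Proof.
by move=> e e0; exists setT => [|x]; [exact: unitI_compact|move/(_ Logic.I)].
Qed.

Section Repar.
Variables (B : cstarAlgType R) (theta : I -> I) (thetac : continuous theta).
Fact repar_cont (f : C0 I B) : continuous (f \o theta).
Proof. by move=> s; apply: continuous_comp; [exact: thetac|exact: c0_cont]. Qed.
Definition repar (f : C0 I B) : C0 I B := MkC0 (@repar_cont f) (@CI_vanish B _).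
Fact repar_le f : `|repar f| <= `|f|.
Proof. by apply: norm_c0_le => // s; exact: le_norm_c0. Qed.
Fact repar_linear (c : R[i]) (x y : C0 I B) :
  repar (c *: x + y) = c *: repar x + repar y.
Proof. exact: c0_eq. Qed.
Fact repar_mul : {morph repar : x y / x ** y}.
Proof. by move=> x y; exact: c0_eq. Qed.
Fact repar_adj : {morph repar : x / adj x}.
Proof. by move=> x; exact: c0_eq. Qed.
Definition sh_repar : starHom (C0 I B) (C0 I B) :=
  MkStarHom repar_linear repar_mul repar_adj repar_le.
End Repar.

Section Cst.
Variables (B : cstarAlgType R).
Definition cstI (b : B) : C0 I B :=
  MkC0 (fun s => cvg_cst b) (@CI_vanish B (fun=> b)).
Fact cstI_le b : `|cstI b| <= `|b|.
Proof. exact: norm_c0_le. Qed.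
Fact cstI_linear (c : R[i]) (x y : B) :
  cstI (c *: x + y) = c *: cstI x + cstI y.
Proof. exact: c0_eq. Qed.
Fact cstI_mul : {morph cstI : x y / x ** y}.
Proof. by move=> x y; exact: c0_eq. Qed.
Fact cstI_adj : {morph cstI : x / adj x}.
Proof. by move=> x; exact: c0_eq. Qed.
Definition sh_cst : starHom B (C0 I B) :=
  MkStarHom cstI_linear cstI_mul cstI_adj cstI_le.
End Cst.

Fact lpath_cont : continuous (fun s : I => clamp (2 * ival s)).
Proof.
move=> s; apply: (@continuous_comp _ _ _ (fun s : I => 2 * ival s : R) clamp).
  exact: (@cvgM R _ _ _ (cst 2) ival 2 (ival s) (cvg_cst _) (@ival_continuous s)).
exact: clamp_continuous.
Qed.
Fact rpath_cont : continuous (fun s : I => clamp (2 * ival s - 1)).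
Proof.
move=> s; apply: (@continuous_comp _ _ _ (fun s : I => 2 * ival s - 1 : R) clamp).
  apply: (@continuousB R R I (fun s => 2 * ival s) (cst 1)); last exact: cst_continuous.
  exact: (@cvgM R _ _ _ (cst 2) ival 2 (ival s) (cvg_cst _) (@ival_continuous s)).
exact: clamp_continuous.
Qed.
Fact opath_cont : continuous (fun s : I => clamp (1 - ival s)).
Proof.
move=> s; apply: (@continuous_comp _ _ _ (fun s : I => 1 - ival s : R) clamp).
  apply: (@continuousB R R I (cst 1) ival); first exact: cst_continuous.
  exact: ival_continuous.
exact: clamp_continuous.
Qed.

Definition glue B (f g : C0 I B) : C0 I B :=
  sh_repar B lpath_cont f - sh_cst B (f I1) + sh_repar B rpath_cont g.

Lemma glueP B (s : I) : (exists u, forall f g : C0 I B, f I1 = g I0 -> glue f g s = f u)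
  \/ (exists u, forall f g : C0 I B, f I1 = g I0 -> glue f g s = g u).
Proof.
have [s1|s1] := leP (2 * ival s) 1.
  left; exists (clamp (2 * ival s)) => f g fg.
  have -> : glue f g s = f (clamp (2 * ival s)) - f I1 + g (clamp (2 * ival s - 1)) by [].
  have -> : clamp (2 * ival s - 1) = I0.
    apply: ival_inj; rewrite !ivalE !max_l// ge_min ?lexx ?orbT//.
    by rewrite subr_le0 s1 orbT.
  by rewrite fg subrK.
right; exists (clamp (2 * ival s - 1)) => f g fg.
have -> : glue f g s = f (clamp (2 * ival s)) - f I1 + g (clamp (2 * ival s - 1)) by [].
have -> : clamp (2 * ival s) = I1.
  by apply: ival_inj; rewrite !ivalE !min_l// ltW.
by rewrite subrr add0r.
Qed.

Lemma glue0 B (f g : C0 I B) : f I1 = g I0 -> glue f g I0 = f I0.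
Proof.
move=> fg.
have -> : glue f g I0 = f (clamp (2 * ival I0)) - f I1 + g (clamp (2 * ival I0 - 1)) by [].
have -> : ival I0 = 0 by rewrite ivalE min_r// max_l.
have -> : clamp (2 * 0 - 1) = I0.
  by apply: ival_inj; rewrite !ivalE mulr0 add0r !max_l// ge_min ?lexx ?orbT// oppr_le0 ler01 orbT.
by rewrite mulr0 fg subrK.
Qed.

Lemma glue1 B (f g : C0 I B) : f I1 = g I0 -> glue f g I1 = g I1.
Proof.
move=> fg.
have -> : glue f g I1 = f (clamp (2 * ival I1)) - f I1 + g (clamp (2 * ival I1 - 1)) by [].
have -> : ival I1 = 1 by rewrite ivalE min_l// max_r.
have -> : clamp (2 * 1) = I1.
  by apply: ival_inj; rewrite !ivalE mulr1 minxx min_l// ler1n.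
by rewrite mulr1 [2]mulr2n addrK subrr add0r.
Qed.

Lemma ival1 : ival I1 = 1 :> R. Proof. by rewrite ivalE min_l// max_r. Qed.
Lemma ival0 : ival I0 = 0 :> R. Proof. by rewrite ivalE min_r// max_l. Qed.

Definition sh_homotopic A B (f g : starHom A B) :=
  exists h : starHom A (C0 I B), forall a, h a I0 = f a /\ h a I1 = g a.

Definition am_homotopic A B (f g : asympMor A B) :=
  exists h : asympMor A (C0 I B),
    forall t a, 0 <= t -> h t a I0 = f t a /\ h t a I1 = g t a.

Lemma sh_homotopic_refl A B (f : starHom A B) : sh_homotopic f f.
Proof. by exists (sh_comp (sh_cst B) f). Qed.

Lemma am_homotopic_refl A B (f : asympMor A B) : am_homotopic f f.
Proof. by exists (am_post (sh_cst B) f). Qed.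

Lemma sh_homotopic_sym A B (f g : starHom A B) :
  sh_homotopic f g -> sh_homotopic g f.
Proof.
move=> [h hfg]; exists (sh_comp (sh_repar B opath_cont) h) => a.
have [h0 h1] := hfg a.
by rewrite /= ival0 ival1 subr0 subrr -/I0 -/I1.
Qed.

Lemma am_homotopic_sym A B (f g : asympMor A B) :
  am_homotopic f g -> am_homotopic g f.
Proof.
move=> [h hfg]; exists (am_post (sh_repar B opath_cont) h) => t a t0.
have [h0 h1] := hfg t a t0.
by rewrite /= ival0 ival1 subr0 subrr -/I0 -/I1.
Qed.

Section ShGlue.
Variables (A B : cstarAlgType R) (h k : starHom A (C0 I B)).
Hypothesis hk : forall a, h a I1 = k a I0.
Let G (a : A) : C0 I B := glue (h a) (k a).
Fact sh_glue_linear (c : R[i]) x y : G (c *: x + y) = c *: G x + G y.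
Proof.
apply: c0_eq => s.
have -> : (c *: G x + G y) s = c *: G x s + G y s by [].
by have [[u gE]|[u gE]] := glueP B s; rewrite /G !gE// sh_linear.
Qed.
Fact sh_glue_mul : {morph G : x y / x ** y}.
Proof.
move=> x y; apply: c0_eq => s.
have -> : (G x ** G y) s = G x s ** G y s by [].
by have [[u gE]|[u gE]] := glueP B s; rewrite /G !gE// sh_mul.
Qed.
Fact sh_glue_adj : {morph G : x / adj x}.
Proof.
move=> x; apply: c0_eq => s.
have -> : adj (G x) s = adj (G x s) by [].
by have [[u gE]|[u gE]] := glueP B s; rewrite /G !gE// sh_adj.
Qed.
Fact sh_glue_le x : `|G x| <= `|x|.
Proof.
apply: norm_c0_le => // s.
by have [[u gE]|[u gE]] := glueP B s; rewrite /G !gE//;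
  rewrite (le_trans (le_norm_c0 _ _))// sh_le.
Qed.
Definition sh_glue : starHom A (C0 I B) :=
  MkStarHom sh_glue_linear sh_glue_mul sh_glue_adj sh_glue_le.
End ShGlue.

Lemma sh_homotopic_trans A B (f g h : starHom A B) :
  sh_homotopic f g -> sh_homotopic g h -> sh_homotopic f h.
Proof.
move=> [k fg] [l gh].
have kl a : k a I1 = l a I0 by rewrite (fg a).2 (gh a).1.
exists (sh_glue kl) => a; split.
  exact: etrans (glue0 (kl a)) (fg a).1.
exact: etrans (glue1 (kl a)) (gh a).2.
Qed.

Section AmGlue.
Variables (A B : cstarAlgType R) (h k : asympMor A (C0 I B)).
Hypothesis hk : forall t a, 0 <= t -> h t a I1 = k t a I0.
Let G (t : R) (a : A) : C0 I B := glue (h t a) (k t a).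
Fact am_glue_cont a : {within `[0, +oo[, continuous (fun t => G t a)}.
Proof.
move=> t; apply: cvgD; first apply: cvgB.
- apply: (@continuous_comp (subspace _) _ _ (fun t => h t a) (sh_repar B lpath_cont)).
    exact: am_cont.
  exact: sh_continuous.
- apply: (@continuous_comp (subspace _) _ _ (fun t => h t a)
           (sh_comp (sh_cst B) (sh_ev B I1))).
    exact: am_cont.
  exact: sh_continuous.
- apply: (@continuous_comp (subspace _) _ _ (fun t => k t a) (sh_repar B rpath_cont)).
    exact: am_cont.
  exact: sh_continuous.
Qed.
Fact am_glue_adj a : G t (adj a) - adj (G t a) @[t --> +oo] --> (0 : C0 I B).
Proof.
apply: as_squeeze (am_adj h a) (am_adj k a) => t t0.
apply: norm_c0_le => [|s]; first by rewrite addr_ge0.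
have -> : (G t (adj a) - adj (G t a)) s = G t (adj a) s - adj (G t a s) by [].
have [[u gE]|[u gE]] := glueP B s; rewrite /G !gE ?hk//.
  by rewrite (le_trans (le_norm_c0 (h t (adj a) - adj (h t a)) u))// lerDl.
by rewrite (le_trans (le_norm_c0 (k t (adj a) - adj (k t a)) u))// lerDr.
Qed.
Fact am_glue_linear a (c : R[i]) b :
  G t (a + c *: b) - G t a - c *: G t b @[t --> +oo] --> (0 : C0 I B).
Proof.
apply: as_squeeze (am_linear h a c b) (am_linear k a c b) => t t0.
apply: norm_c0_le => [|s]; first by rewrite addr_ge0.
have -> : (G t (a + c *: b) - G t a - c *: G t b) s =
  G t (a + c *: b) s - G t a s - c *: G t b s by [].
have [[u gE]|[u gE]] := glueP B s; rewrite /G !gE ?hk//.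
  by rewrite (le_trans (le_norm_c0 (h t (a + c *: b) - h t a - c *: h t b) u))// lerDl.
by rewrite (le_trans (le_norm_c0 (k t (a + c *: b) - k t a - c *: k t b) u))// lerDr.
Qed.
Fact am_glue_mul a b : G t (a ** b) - G t a ** G t b @[t --> +oo] --> (0 : C0 I B).
Proof.
apply: as_squeeze (am_mul h a b) (am_mul k a b) => t t0.
apply: norm_c0_le => [|s]; first by rewrite addr_ge0.
have -> : (G t (a ** b) - G t a ** G t b) s = G t (a ** b) s - G t a s ** G t b s by [].
have [[u gE]|[u gE]] := glueP B s; rewrite /G !gE ?hk//.
  by rewrite (le_trans (le_norm_c0 (h t (a ** b) - h t a ** h t b) u))// lerDl.
by rewrite (le_trans (le_norm_c0 (k t (a ** b) - k t a ** k t b) u))// lerDr.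
Qed.
Definition am_glue : asympMor A (C0 I B) :=
  MkAsympMor am_glue_cont am_glue_adj am_glue_linear am_glue_mul.
End AmGlue.

Lemma am_homotopic_trans A B (f g h : asympMor A B) :
  am_homotopic f g -> am_homotopic g h -> am_homotopic f h.
Proof.
move=> [k fg] [l gh].
have kl t a : 0 <= t -> k t a I1 = l t a I0.
  by move=> t0; rewrite (fg t a t0).2 (gh t a t0).1.
exists (am_glue kl) => t a t0; split.
  exact: etrans (glue0 (kl t a t0)) (fg t a t0).1.
exact: etrans (glue1 (kl t a t0)) (gh t a t0).2.
Qed.

Definition sh_homotopicb A B : rel (starHom A B) := fun f g => `[< sh_homotopic f g >].
Definition am_homotopicb A B : rel (asympMor A B) := fun f g => `[< am_homotopic f g >].

Fact sh_homotopicb_equiv A B : equiv_class_of (@sh_homotopicb A B).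
Proof.
split=> [f|f g|g f h].
- by apply/asboolP; exact: sh_homotopic_refl.
- by apply/asboolP/asboolP; exact: sh_homotopic_sym.
- by move=> /asboolP fg /asboolP gh; apply/asboolP; exact: sh_homotopic_trans gh.
Qed.
Fact am_homotopicb_equiv A B : equiv_class_of (@am_homotopicb A B).
Proof.
split=> [f|f g|g f h].
- by apply/asboolP; exact: am_homotopic_refl.
- by apply/asboolP/asboolP; exact: am_homotopic_sym.
- by move=> /asboolP fg /asboolP gh; apply/asboolP; exact: am_homotopic_trans gh.
Qed.

Canonical sh_homotopy A B := EquivRelPack (@sh_homotopicb_equiv A B).
Canonical am_homotopy A B := EquivRelPack (@am_homotopicb_equiv A B).

Definition homClass A B := {eq_quot (sh_homotopy A B)}.
Definition asympClass A B := {eq_quot (am_homotopy A B)}.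

Definition hclass A B (f : starHom A B) : homClass A B := \pi f.
Definition aclass A B (f : asympMor A B) : asympClass A B := \pi f.

Lemma hclassP A B (f g : starHom A B) : hclass f = hclass g <-> sh_homotopic f g.
Proof. by split=> [/eqmodP/asboolP|fg]//; apply/eqmodP/asboolP. Qed.
Lemma aclassP A B (f g : asympMor A B) : aclass f = aclass g <-> am_homotopic f g.
Proof. by split=> [/eqmodP/asboolP|fg]//; apply/eqmodP/asboolP. Qed.

Definition hcomp A B C (x : homClass B C) (y : homClass A B) : homClass A C :=
  hclass (sh_comp (repr x) (repr y)).
Definition acomp A B C (x : homClass B C) (y : asympClass A B) : asympClass A C :=
  aclass (am_post (repr x) (repr y)).

Lemma hcompE A B C (f : starHom B C) (g : starHom A B) :
  hcomp (hclass f) (hclass g) = hclass (sh_comp f g).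
Proof.
have /hclassP[h hf] : hclass (repr (hclass f)) = hclass f by rewrite /hclass reprK.
have /hclassP[k kg] : hclass (repr (hclass g)) = hclass g by rewrite /hclass reprK.
apply/hclassP; apply: (@sh_homotopic_trans _ _ _ (sh_comp (repr (hclass f)) g)).
  exists (sh_comp (sh_post I (repr (hclass f))) k) => a /=.
  by rewrite (kg a).1 (kg a).2.
by exists (sh_comp h g) => a /=; rewrite (hf (g a)).1 (hf (g a)).2.
Qed.

Lemma acompE A B C (f : starHom B C) (g : asympMor A B) :
  acomp (hclass f) (aclass g) = aclass (am_post f g).
Proof.
have /hclassP[h hf] : hclass (repr (hclass f)) = hclass f by rewrite /hclass reprK.
have /aclassP[k kg] : aclass (repr (aclass g)) = aclass g by rewrite /aclass reprK.
apply/aclassP; apply: (@am_homotopic_trans _ _ _ (am_post (repr (hclass f)) g)).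
  exists (am_post (sh_post I (repr (hclass f))) k) => t a t0 /=.
  by rewrite (kg t a t0).1 (kg t a t0).2.
by exists (am_post h g) => t a t0 /=; rewrite (hf (g t a)).1 (hf (g t a)).2.
Qed.
End UnitInterval.

Record bimorphism (R : realType) (A B D : cstarAlgType R) := MkBimorphism {
  bm_fun :> A -> B -> D;
  bm_linearl : forall (c : R[i]) x x' y,
    bm_fun (c *: x + x') y = c *: bm_fun x y + bm_fun x' y;
  bm_linearr : forall (c : R[i]) x y y',
    bm_fun x (c *: y + y') = c *: bm_fun x y + bm_fun x y';
  bm_mul : forall x x' y y', bm_fun (x ** x') (y ** y') = bm_fun x y ** bm_fun x' y';
  bm_adj : forall x y, bm_fun (adj x) (adj y) = adj (bm_fun x y)
}.

Record tensorProduct (R : realType) (A B : cstarAlgType R) := MkTensorProduct {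
  tp_alg :> cstarAlgType R;
  tp_map : bimorphism A B tp_alg;
  tp_lift : forall D : cstarAlgType R, bimorphism A B D -> starHom tp_alg D;
  tp_liftE : forall (D : cstarAlgType R) (u : bimorphism A B D) x y,
    tp_lift u (tp_map x y) = u x y;
  tp_uniq : forall (D : cstarAlgType R) (f g : starHom tp_alg D),
    (forall x y, f (tp_map x y) = g (tp_map x y)) -> f = g
}.

Record freeProduct (R : realType) (A B : cstarAlgType R) := MkFreeProduct {
  fp_alg :> cstarAlgType R;
  fp_in1 : starHom A fp_alg;
  fp_in2 : starHom B fp_alg;
  fp_lift : forall D : cstarAlgType R, starHom A D -> starHom B D -> starHom fp_alg D;
  fp_lift1 : forall (D : cstarAlgType R) (f : starHom A D) (g : starHom B D) x,
    fp_lift f g (fp_in1 x) = f x;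
  fp_lift2 : forall (D : cstarAlgType R) (f : starHom A D) (g : starHom B D) x,
    fp_lift f g (fp_in2 x) = g x;
  fp_uniq : forall (D : cstarAlgType R) (f g : starHom fp_alg D),
    (forall x, f (fp_in1 x) = g (fp_in1 x)) ->
    (forall x, f (fp_in2 x) = g (fp_in2 x)) -> f = g
}.

Section Functors.
Context {R : realType}.
Implicit Types A B C D : cstarAlgType R.

Section TensorMap.
Variables (A A' B B' : cstarAlgType R).
Variables (T : tensorProduct A B) (T' : tensorProduct A' B').
Variables (f : starHom A A') (g : starHom B B').
Let u x y := tp_map T' (f x) (g y).
Fact tmap_linearl (c : R[i]) x x' y : u (c *: x + x') y = c *: u x y + u x' y.
Proof. by rewrite /u sh_linear bm_linearl. Qed.
Fact tmap_linearr (c : R[i]) x y y' : u x (c *: y + y') = c *: u x y + u x y'.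
Proof. by rewrite /u sh_linear bm_linearr. Qed.
Fact tmap_mul x x' y y' : u (x ** x') (y ** y') = u x y ** u x' y'.
Proof. by rewrite /u !sh_mul bm_mul. Qed.
Fact tmap_adj x y : u (adj x) (adj y) = adj (u x y).
Proof. by rewrite /u !sh_adj bm_adj. Qed.
Definition sh_tensor : starHom T T' :=
  tp_lift T (MkBimorphism tmap_linearl tmap_linearr tmap_mul tmap_adj).
End TensorMap.

Definition closed_ideal A (J : set A) :=
  [/\ closed J, J 0, forall (c : R[i]) x y, J x -> J y -> J (c *: x + y) &
      forall x y, J x -> J (x ** y) /\ J (y ** x)].

Definition ideal_generated A (G : set A) : set A :=
  [set x | forall J, closed_ideal J -> G `<=` J -> J x].

Lemma ideal_generated_subalgebra A (G : set A) : (forall x, G x -> G (adj x)) ->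
  closed_subalgebra (ideal_generated G).
Proof.
move=> Gadj; split.
- rewrite (_ : ideal_generated G =
    \bigcap_(J in [set J | closed_ideal J /\ G `<=` J]) J).
    by apply: closed_bigI => J [[]].
  by apply/seteqP; split=> x xJ J; [case; exact: xJ|move=> ? ?; exact: xJ].
- by move=> J [].
- by move=> c x y xG yG J iJ GJ; case: (iJ) => _ _ + _; apply; [exact: xG|exact: yG].
- by move=> x y xG yG J iJ GJ; case: (iJ) => _ _ _ h; apply: (h _ _ _).1; exact: xG.
- move=> x xG J iJ GJ; have [Jcl J0 Jlin Jid] := iJ.
  apply: (xG [set y | J (adj y)]) => [|y Gy]; last exact: GJ (Gadj _ Gy).
  split.
  + by move/continuous_closedP : (@adj_continuous R A) => /(_ _ Jcl).
  + by rewrite /= adj0.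
  + by move=> c y z Jy Jz /=; rewrite adjD adjZ; exact: Jlin.
  + by move=> y z Jy /=; rewrite !adjM; split; [apply: (Jid _ _ _).2|apply: (Jid _ _ _).1].
Qed.

Section Incl.
Variables (A : cstarAlgType R) (S : set A) (hS : closed_subalgebra S).
Definition sh_incl : starHom (subalg hS) A :=
  @MkStarHom R (subalg hS) A (@proj1_sig A S) (fun c x y => erefl)
    (fun x y => erefl) (fun x => erefl) (fun x => lexx _).
End Incl.

Section Q.
Variables (A : cstarAlgType R) (F : freeProduct A A).

Definition q_generators : set F := range (fun x => fp_in1 F x - fp_in2 F x).

Fact q_generators_adj x : q_generators x -> q_generators (adj x).
Proof. by move=> [y _ <-]; exists (adj y) => //; rewrite !sh_adj adjB. Qed.

Definition qalg : cstarAlgType R :=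
  subalg (ideal_generated_subalgebra q_generators_adj).

Definition qmap B (f g : starHom A B) : starHom qalg B :=
  sh_comp (fp_lift F f g) (sh_incl (ideal_generated_subalgebra q_generators_adj)).
End Q.
End Functors.

Section Separability.
Context {R : realType}.
Implicit Types A B : cstarAlgType R.

Lemma denseP A (W : set A) : dense W <->
  forall (x : A) (e : R[i]), 0 < e -> exists2 w, W w & `|x - w| < e.
Proof.
split=> [Wd x e e0|Wd O [x Ox] Oo].
  have := Wd (interior (ball x e)).
  case; first by exists x; exact: nbhsx_ballx.
    exact: open_interior.
  move=> w [/interior_subset]; rewrite -ball_normE /= => xw Ww.
  by exists w.
have : nbhs x O by exact: open_nbhs_nbhs.
move/nbhs_ballP => [e e0 xO]; have [w Ww xw] := Wd x e e0.
by exists w; split=> //; apply: xO; rewrite -ball_normE.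
Qed.

Lemma image_countable (T U : Type) (f : T -> U) (D : set T) :
  countable D -> countable (f @` D).
Proof. by move=> cD; apply: card_le_trans (card_image_le _ _) cD. Qed.

Lemma archi_inv (e : R[i]) : 0 < e -> exists n : nat, (n.+1%:R)^-1 < e.
Proof.
move=> e0; have Re0 : 0 < complex.Re e by rewrite -ltcR ReE// ltW.
have /filter_ex[n nE] := near_infty_natSinv_lt (PosNum Re0).
exists n; rewrite -(ReE (ltW e0)) -[n.+1%:R](rmorph_nat (real_complex R)) -fmorphV.
by rewrite ltcR.
Qed.

Lemma setU_countable (T : Type) (D E : set T) :
  countable D -> countable E -> countable (D `|` E).
Proof.
by move=> cD cE; rewrite -bigcup2E; apply: bigcup_countable => // -[|[|n]].
Qed.

Lemma subalg_separable A (S : set A) (hS : closed_subalgebra S) :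
  separable A -> separable (subalg hS).
Proof.
move=> [W cW /denseP Wd].
pose near_ (p : A * nat) (s : subalg hS) :=
  `|p.1 - proj1_sig s| < (p.2.+1%:R)^-1.
pose pick_ p : subalg hS := xget 0 [set s | near_ p s].
exists (pick_ @` (W `*` setT)).
  by apply/image_countable/countableX.
apply/denseP => x e e0; have [|n en] := @archi_inv (e / 2).
  by rewrite divr_gt0.
have [|w Ww xw] := Wd (proj1_sig x) (n.+1%:R)^-1; first by rewrite invr_gt0 ltr0n.
exists (pick_ (w, n)); first by exists (w, n).
have /(_ x) : forall s, near_ (w, n) s -> near_ (w, n) (pick_ (w, n)).
  by move=> s ws; exact: (@xgetPex _ 0 [set s | near_ (w, n) s] (ex_intro _ s ws)).
rewrite /near_ /= distrC => /(_ xw) wp.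
have -> : `|x - pick_ (w, n)| = `|proj1_sig x - proj1_sig (pick_ (w, n))| by [].
rewrite -(subrK w (proj1_sig x)) -addrA (le_lt_trans (ler_normD _ _))//.
by rewrite (splitr e) ltrD// (lt_trans _ en).
Qed.

Definition ratC : set R[i] := [set c | exists p q : rat, c = (ratr p +i* ratr q)%C].

Lemma ratC_countable : countable ratC.
Proof.
apply: (@sub_countable _ _ _ ((fun p : rat * rat => (ratr p.1 +i* ratr p.2)%C : R[i]) @` setT)).
  by apply: subset_card_le => _ [p [q ->]]; exists (p, q).
by apply: image_countable; exact: countableP.
Qed.

Lemma ratC_dense (c e : R[i]) : 0 < e -> exists2 q, ratC q & `|c - q| < e.
Proof.
move=> e0; have Re0 : 0 < complex.Re e by rewrite -ltcR ReE// ltW.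
have rd (a : R) : exists q : rat, `|a - ratr q| < complex.Re e / 2.
  have [|q] := @rat_in_itvoo R (a - complex.Re e / 2) a.
    by rewrite ltrBlDr ltrDl divr_gt0.
  rewrite in_itv /= => /andP[aq qa]; exists q.
  by rewrite ger0_norm ?subr_ge0 1?ltW// ltrBlDr -ltrBlDl.
have [p pE] := rd (complex.Re c); have [q qE] := rd (complex.Im c).
exists (ratr p +i* ratr q)%C; first by exists p, q.
case: c pE qE => a b /= pE qE.
have -> : (a +i* b)%C - (ratr p +i* ratr q)%C =
    (a - ratr p)%:C%C + 'i%C * (b - ratr q)%:C%C :> R[i].
  by apply/eqP; rewrite eq_complex/= !(mul0r,mul1r,add0r,addr0,subr0,mulr0,oppr0) !eqxx.
rewrite (le_lt_trans (ler_normD _ _))// normrM.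
have -> : `|'i%C| = 1 :> R[i] by rewrite normc_def/= expr0n/= expr1n add0r sqrtr1.
rewrite mul1r !normc_def /= expr0n /= !addr0 !sqrtr_sqr -rmorphD/=.
by rewrite -(ReE (ltW e0)) ltcR (splitr (complex.Re e)) ltrD.
Qed.

Section Generated.
Variables (A : cstarAlgType R) (G : set A).

Definition alg_step (S : set A) : set A :=
  S `|` ((fun p => p.1 + p.2) @` (S `*` S)) `|` ((fun p => p.1 ** p.2) @` (S `*` S))
    `|` (adj @` S) `|` ((fun p => p.1 *: p.2) @` (ratC `*` S)).

Definition ratalg : set A := \bigcup_n iter n alg_step G.

Lemma ratalg_countable : countable G -> countable ratalg.
Proof.
move=> cG; apply: bigcup_countable => // n _; elim: n => //= n cn.
by rewrite /alg_step; do !apply: setU_countable => //; apply: image_countable => //;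
  apply: countableX => //; exact: ratC_countable.
Qed.

Lemma iter_step_mono n m : (n <= m)%N -> iter n alg_step G `<=` iter m alg_step G.
Proof.
by move=> /subnKC <-; elim: (m - n)%N => [|k IH] x; rewrite ?addn0// addnS => /IH; do 4 left.
Qed.

Lemma ratalgD x y : ratalg x -> ratalg y -> ratalg (x + y).
Proof.
move=> [n _ nx] [m _ my]; exists (maxn n m).+1 => //=; do 3 left; right; exists (x, y) => //.
by split; [apply: iter_step_mono nx; exact: leq_maxl|apply: iter_step_mono my; exact: leq_maxr].
Qed.
Lemma ratalgM x y : ratalg x -> ratalg y -> ratalg (x ** y).
Proof.
move=> [n _ nx] [m _ my]; exists (maxn n m).+1 => //=; do 2 left; right; exists (x, y) => //.
by split; [apply: iter_step_mono nx; exact: leq_maxl|apply: iter_step_mono my; exact: leq_maxr].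
Qed.
Lemma ratalgJ x : ratalg x -> ratalg (adj x).
Proof. by move=> [n _ nx]; exists n.+1 => //=; left; right; exists x. Qed.
Lemma ratalgZ c x : ratC c -> ratalg x -> ratalg (c *: x).
Proof. by move=> cq [n _ nx]; exists n.+1 => //=; right; exists (c, x). Qed.

Definition ratcl : set A :=
  [set x | forall e : R[i], 0 < e -> exists2 w, ratalg w & `|x - w| < e].

Lemma ratcl_id x : (forall e : R[i], 0 < e -> exists2 y, ratcl y & `|x - y| < e) ->
  ratcl x.
Proof.
move=> h e e0; have e2 : 0 < e / 2 by rewrite divr_gt0.
have [y ycl xy] := h _ e2; have [w Ww yw] := ycl _ e2; exists w => //.
by rewrite -(subrK y x) -addrA (le_lt_trans (ler_normD _ _))// (splitr e) ltrD.
Qed.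

Lemma ratcl_lip (M : R[i]) (f : A -> A) : 0 <= M ->
  (forall x y, `|f x - f y| <= M * `|x - y|) ->
  (forall w, ratalg w -> ratcl (f w)) -> forall x, ratcl x -> ratcl (f x).
Proof.
move=> M0 fM fW x xcl; apply: ratcl_id => e e0.
have M1 : 0 < M + 1 by rewrite ltr_wpDl.
have [|w Ww xw] := xcl (e / (M + 1)); first by rewrite divr_gt0.
exists (f w); first exact: fW.
rewrite (le_lt_trans (fM _ _))// (@le_lt_trans _ _ ((M + 1) * `|x - w|))//.
  by rewrite ler_wpM2r// lerDl.
by rewrite mulrC -ltr_pdivlMr.
Qed.

Lemma ratalg_cl x : ratalg x -> ratcl x.
Proof. by move=> Wx e e0; exists x => //; rewrite subrr normr0. Qed.

Lemma ratcl_closed_subalgebra : G !=set0 -> closed_subalgebra ratcl.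
Proof.
move=> [g Gg].
have Wg : ratalg g by exists 0%N.
have clD x y : ratcl x -> ratcl y -> ratcl (x + y).
  move=> xcl ycl; move: x xcl; apply: (@ratcl_lip 1 (fun x => x + y)) => //.
    by move=> x x'; rewrite mul1r opprD addrACA subrr addr0.
  move=> w Ww; move: y ycl; apply: (@ratcl_lip 1 (fun y => w + y)) => //.
    by move=> y y'; rewrite mul1r opprD addrACA subrr add0r.
  by move=> w' Ww'; apply/ratalg_cl/ratalgD.
have clZ (c : R[i]) x : ratcl x -> ratcl (c *: x).
  move: x; apply: (@ratcl_lip `|c| (fun x => c *: x)) => //.
    by move=> x y; rewrite -scalerBr normrZ.
  move=> w Ww; apply: ratcl_id => e e0.
  have [|q qQ cq] := @ratC_dense c (e / (`|w| + 1)).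
    by rewrite divr_gt0// ltr_wpDl.
  exists (q *: w); first by apply/ratalg_cl/ratalgZ.
  rewrite -scalerBl normrZ (@le_lt_trans _ _ (`|c - q| * (`|w| + 1)))//.
    by rewrite ler_wpM2l// lerDl.
  by rewrite -ltr_pdivlMr// ltr_wpDl.
split.
- move=> x xcl; apply: ratcl_id => e e0.
  have [y [ycl]] := xcl _ (nbhsx_ballx x e e0).
  by rewrite -ball_normE => xy; exists y.
- by rewrite -(scale0r g); apply/clZ/ratalg_cl.
- by move=> c x y xcl ycl; apply: clD => //; exact: clZ.
- move=> x y xcl ycl; move: x xcl; apply: (@ratcl_lip `|y| (fun x => x ** y)) => //.
    by move=> x x'; rewrite -cmulBl mulrC ler_norm_cmul.
  move=> w Ww; move: y ycl; apply: (@ratcl_lip `|w| (fun y => w ** y)) => //.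
    by move=> y y'; rewrite -cmulBr ler_norm_cmul.
  by move=> w' Ww'; apply/ratalg_cl/ratalgM.
- apply: (@ratcl_lip 1 (@adj R A)) => //.
    by move=> x y; rewrite -adjB norm_adj mul1r.
  by move=> w Ww; apply/ratalg_cl/ratalgJ.
Qed.
End Generated.

Section Corestrict.
Variables (A B : cstarAlgType R) (S : set B) (hS : closed_subalgebra S).
Variables (f : starHom A B) (fS : forall x, S (f x)).
Let g x : subalg hS := exist _ _ (fS x).
Fact cores_linear (c : R[i]) x y : g (c *: x + y) = c *: g x + g y.
Proof. by apply: sub_inj; exact: sh_linear. Qed.
Fact cores_mul : {morph g : x y / x ** y}.
Proof. by move=> x y; apply: sub_inj; exact: sh_mul. Qed.
Fact cores_adj : {morph g : x / adj x}.
Proof. by move=> x; apply: sub_inj; exact: sh_adj. Qed.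
Fact cores_le x : `|g x| <= `|x|. Proof. exact: sh_le. Qed.
Definition sh_cores : starHom A (subalg hS) :=
  MkStarHom cores_linear cores_mul cores_adj cores_le.
End Corestrict.

Lemma freeProduct_separable A B (F : freeProduct A B) :
  separable A -> separable B -> separable F.
Proof.
move=> [V cV /denseP Vd] [W cW /denseP Wd].
pose G : set F := (fp_in1 F @` V) `|` (fp_in2 F @` W).
have cG : countable G by apply: setU_countable; exact: image_countable.
have G0 : G !=set0.
  by have [v Vv _] := Vd 0 1 ltr01; exists (fp_in1 F v); left; exists v.
have in1 x : ratcl G (fp_in1 F x).
  move=> e e0; have [v Vv xv] := Vd x e e0; exists (fp_in1 F v).
    by exists 0%N => //; left; exists v.
  by rewrite -shB (le_lt_trans (sh_le _ _)).
have in2 x : ratcl G (fp_in2 F x).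
  move=> e e0; have [v Wv xv] := Wd x e e0; exists (fp_in2 F v).
    by exists 0%N => //; right; exists v.
  by rewrite -shB (le_lt_trans (sh_le _ _)).
have hG := ratcl_closed_subalgebra G0.
pose L := fp_lift F (sh_cores hG in1) (sh_cores hG in2).
have LE : sh_comp (sh_incl hG) L = sh_id F.
  by apply: fp_uniq => x; rewrite /= /L ?fp_lift1 ?fp_lift2.
exists (ratalg G); first exact: ratalg_countable.
apply/denseP => x e e0.
have <- : proj1_sig (L x) = x := congr1 (fun h : starHom F F => h x) LE.
exact: (proj2_sig (L x)).
Qed.

Lemma qalg_separable A (F : freeProduct A A) : separable A -> separable (qalg F).
Proof. by move=> sA; apply/subalg_separable/freeProduct_separable. Qed.
End Separability.

Record innerProduct (R : realType) (H : completeNormedModType R[i]) := MkInner {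
  inner :> H -> H -> R[i];
  inner_linear : forall (c : R[i]) x y z,
    inner (c *: x + y) z = c * inner x z + inner y z;
  inner_conj : forall x y, inner y x = (inner x y)^*;
  inner_norm : forall x, inner x x = `|x| ^+ 2
}.

Definition finite_dimensional (R : realType) (H : normedModType R[i]) :=
  exists n (v : 'I_n -> H), forall x, exists c : 'I_n -> R[i],
    x = \sum_(i < n) c i *: v i.

Definition compact_operator (R : realType) (H : normedModType R[i]) (T : H -> H) :=
  (forall (c : R[i]) x y, T (c *: x + y) = c *: T x + T y) /\
  compact (closure (T @` [set x | `|x| <= 1])).

Record compactOperators (R : realType) := MkCompactOperators {
  co_space : completeNormedModType R[i];
  co_inner : innerProduct co_space;
  co_separable : separable co_space;
  co_infinite : ~ finite_dimensional co_space;
  co_alg :> cstarAlgType R;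
  co_op : co_alg -> co_space -> co_space;
  co_compact : forall T : co_space -> co_space,
    compact_operator T <-> exists k, co_op k = T;
  co_linear : forall (c : R[i]) k l x, co_op (c *: k + l) x = c *: co_op k x + co_op l x;
  co_mul : forall k l x, co_op (k ** l) x = co_op k (co_op l x);
  co_adj : forall k x y, co_inner (co_op (adj k) x) y = co_inner x (co_op k y);
  co_norm_ub : forall k x, `|co_op k x| <= `|k| * `|x|;
  co_norm_lub : forall k (M : R[i]), 0 <= M ->
    (forall x, `|co_op k x| <= M * `|x|) -> `|k| <= M
}.

Definition rank_one_projection (R : realType) (K : compactOperators R) (e : K) :=
  exists2 xi : co_space K, `|xi| = 1 & forall x, co_op e x = co_inner K x xi *: xi.

Definition unitization (R : realType) (A : cstarAlgType R) : Type := (R[i]^o * A)%type.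

Section K0.
Context {R : realType}.
Implicit Types A B : cstarAlgType R.

HB.instance Definition _ A := NormedModule.on (unitization A).

Definition umul A (x y : unitization A) : unitization A :=
  (x.1 * y.1, x.1 *: y.2 + y.1 *: x.2 + x.2 ** y.2).
Definition uone A : unitization A := (1, 0).

Fact umulA A : associative (@umul A).
Proof.
move=> [a x] [b y] [c z]; congr pair; rewrite /= ?mulrA//.
rewrite !(scalerDr, cmulDl, cmulDr, scalerA, cmulZl, cmulZr, cmulA) !addrA.
by rewrite [c * a]mulrC [c * b]mulrC [LHS](ACl (1*2*4*6*3*5*7)%AC).
Qed.
Fact umul1l A : left_id (uone A) (@umul A).
Proof. by move=> [a x]; rewrite /umul /= mul1r scale1r scaler0 cmul0l !addr0. Qed.
Fact umul1r A : right_id (uone A) (@umul A).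
Proof. by move=> [a x]; rewrite /umul /= mulr1 scale1r scaler0 cmul0r add0r !addr0. Qed.
Fact umulDl A : left_distributive (@umul A) +%R.
Proof.
move=> [a x] [b y] [c z]; congr pair; rewrite /= ?mulrDl//.
by rewrite scalerDl scalerDr cmulDl [X in X + _ = _]addrACA [LHS]addrACA.
Qed.
Fact umulDr A : right_distributive (@umul A) +%R.
Proof.
move=> [a x] [b y] [c z]; congr pair; rewrite /= ?mulrDr//.
by rewrite scalerDl scalerDr cmulDr [X in X + _ = _]addrACA [LHS]addrACA.
Qed.
HB.instance Definition _ A := GRing.Zmodule_isPzRing.Build (unitization A)
  (@umulA A) (@umul1l A) (@umul1r A) (@umulDl A) (@umulDr A).

Definition uadj A (x : unitization A) : unitization A := (x.1^*, adj x.2).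

Definition adjmx A m n (M : 'M[unitization A]_(m, n)) : 'M[unitization A]_(n, m) :=
  (map_mx (@uadj A) M)^T.

Definition is_projection A n (p : 'M[unitization A]_n) :=
  p *m p = p /\ adjmx p = p.

Definition mvn_equiv A m n (p : 'M[unitization A]_m) (q : 'M[unitization A]_n) :=
  exists v : 'M[unitization A]_(n, m), adjmx v *m v = p /\ v *m adjmx v = q.

Definition dsum A m n (p : 'M[unitization A]_m) (q : 'M[unitization A]_n) :=
  block_mx p 0 0 q.

Definition K0_eq A m n k l (p : 'M[unitization A]_m) (q : 'M[unitization A]_n)
    (p' : 'M[unitization A]_k) (q' : 'M[unitization A]_l) :=
  exists j (s : 'M[unitization A]_j), is_projection s /\
    mvn_equiv (dsum (dsum p q') s) (dsum (dsum p' q) s).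

Definition am_unitization A B (f : asympMor A B) (t : R) (x : unitization A) :
  unitization B := (x.1, f t x.2).

Definition asymp_image A B (f : asympMor A B) n (p : 'M[unitization A]_n)
    (q : R -> 'M[unitization B]_n) :=
  (forall t, is_projection (q t)) /\
  forall i j, am_unitization f t (p i j) - q t i j @[t --> +oo] --> (0 : unitization B).

Definition K0_maps A B (f : asympMor A B) m n k l (p : 'M[unitization A]_m)
    (q : 'M[unitization A]_n) (p' : 'M[unitization B]_k) (q' : 'M[unitization B]_l) :=
  exists (pt : R -> 'M[unitization B]_m) (qt : R -> 'M[unitization B]_n),
    [/\ asymp_image f p pt, asymp_image f q qt &
        \forall t \near +oo, K0_eq (pt t) (qt t) p' q'].
End K0.


Definition C0R2 (R : realType) : cstarAlgType R := C0 (R * R)%type (Cplx R).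

Section Bott.
Context {R : realType}.

Definition toC (p : R * R) : R[i] := (p.1 +i* p.2)%C.
Definition bott_diag (p : R * R) : Cplx R := (1 + toC p * (toC p)^*)^-1.
Definition bott_off (p : R * R) : Cplx R := toC p / (1 + toC p * (toC p)^*).

Fact toC_cont : continuous (toC : R * R -> R[i]^o).
Proof.
move=> [x y]; apply/cvgrPdist_lt => e e0.
have Re0 : 0 < complex.Re e by rewrite -ltcR ReE// ltW.
have e2 : 0 < complex.Re e / 2 by rewrite divr_gt0.
have key (p : R * R) : `|x - p.1| < complex.Re e / 2 -> `|y - p.2| < complex.Re e / 2 ->
    `|(toC (x, y) : R[i]^o) - toC p| < e.
  case: p => u v /= xu yv.
  have -> : (toC (x, y) : R[i]^o) - toC (u, v) = (x - u)%:C%C + 'i%C * (y - v)%:C%C :> R[i].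
    by apply/eqP; rewrite eq_complex/= !(mul0r,mul1r,add0r,addr0,subr0,mulr0,oppr0) !eqxx.
  rewrite (le_lt_trans (ler_normD _ _))// normrM.
  have -> : `|'i%C| = 1 :> R[i] by rewrite normc_def/= expr0n/= expr1n add0r sqrtr1.
  rewrite mul1r !normc_def /= expr0n /= !addr0 !sqrtr_sqr -rmorphD/=.
  by rewrite -(ReE (ltW e0)) ltcR (splitr (complex.Re e)) ltrD.
have c1 : fst @ nbhs (x, y) --> x by exact: cvg_fst.
have c2 : snd @ nbhs (x, y) --> y by exact: cvg_snd.
near=> p; apply: key; near: p.
  by move/cvgrPdist_lt : c1 => /(_ _ e2).
by move/cvgrPdist_lt : c2 => /(_ _ e2).
Unshelve. all: by end_near. Qed.

Fact bott_den_gt0 p : 0 < 1 + toC p * (toC p)^*.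
Proof. by rewrite ltr_wpDr// -normCK exprn_ge0. Qed.

Fact bott_diag_cont : continuous bott_diag.
Proof.
move=> p; apply: (@cvgV R[i] _ _ _ (fun p => 1 + toC p * (toC p)^*)).
  by rewrite gt_eqF// bott_den_gt0.
have h : (fun p => (toC p : Cplx R) ** adj (toC p : Cplx R)) @ p -->
    (toC p : Cplx R) ** adj (toC p : Cplx R).
  apply: cmul_cvg; first exact: toC_cont.
  apply: (@continuous_comp _ _ _ (toC : R * R -> Cplx R) (@adj R (Cplx R))).
    exact: toC_cont.
  exact: adj_continuous.
exact: (cvgD (cvg_cst (1 : Cplx R)) h).
Qed.

Fact bott_off_cont : continuous bott_off.
Proof.
move=> p; apply: (@cmul_cvg _ _ _ (Cplx R) toC bott_diag).
  exact: toC_cont.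
exact: bott_diag_cont.
Qed.

Fact bott_bound (p : R * R) : toC p != 0 ->
  `|bott_diag p| <= `|toC p|^-1 /\ `|bott_off p| <= `|toC p|^-1.
Proof.
move=> p0; have np : 0 < `|toC p| by rewrite normr_gt0.
have d0 := bott_den_gt0 p.
have E : `|1 + toC p * (toC p)^*| = 1 + `|toC p| ^+ 2.
  by rewrite gtr0_norm// normCK.
have D0 : 0 < 1 + `|toC p| ^+ 2 by rewrite -E normr_gt0 gt_eqF.
have -> : `|bott_off p| = `|toC p| * `|1 + toC p * (toC p)^*|^-1.
  by rewrite /bott_off norm_Cplx normrM normfV.
have -> : `|bott_diag p| = `|1 + toC p * (toC p)^*|^-1.
  by rewrite /bott_diag norm_Cplx normfV.
rewrite E; split.
  rewrite lef_pV2 ?posrE//.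
  have h : 0 <= (`|toC p| - 1) ^+ 2.
    by rewrite -realEsqr rpredB// ?realE ?normr_ge0// ler01.
  have : 2 * `|toC p| <= 1 + `|toC p| ^+ 2.
    by move: h; rewrite sqrrB1 addrAC subr_ge0 mulr_natl addrC.
  by apply: le_trans; rewrite mulr_natl mulr2n lerDl ltW.
rewrite -lter_pdivlMr ?invr_gt0// invrK.
by rewrite -[X in _ <= X]mulrC ler_pdivlMr// -expr2 lerDr.
Qed.

Fact bott_vanish (f : R * R -> Cplx R) :
  (forall p, toC p != 0 -> `|f p| <= `|toC p|^-1) -> vanishes_at_infinity f.
Proof.
move=> fp e e0; have Re0 : 0 < complex.Re e by rewrite -ltcR ReE// ltW.
pose M := (complex.Re e)^-1; have M0 : 0 < M by rewrite invr_gt0.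
exists (`[- M, M]%classic `*` `[- M, M]%classic).
  by apply: compact_setX; exact: segment_compact.
move=> [x y] nC.
have Mz : M%:C%C < `|toC (x, y)|.
  have [xM|xM] := ltP M `|x|.
    by apply: lt_le_trans (normc_ge_Re (toC (x, y))); rewrite ltcR.
  have [yM|yM] := ltP M `|y|.
    rewrite normc_def ltcR /=; apply: lt_le_trans yM _.
    by rewrite -sqrtr_sqr ler_wsqrtr// lerDr sqr_ge0.
  by exfalso; apply: nC; split; rewrite /= in_itv /= -ler_norml.
have M0' : 0 < M%:C%C :> R[i] by rewrite ltcR.
have z0 : 0 < `|toC (x, y)| by exact: lt_trans Mz.
apply: le_lt_trans (fp _ _) _; first by rewrite -normr_gt0.
by rewrite -(ReE (ltW e0)) -(invrK (complex.Re e)) fmorphV ltf_pV2 ?posrE.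
Qed.

Definition bottD : C0R2 R :=
  MkC0 bott_diag_cont (bott_vanish (fun p p0 => (bott_bound p0).1)).
Definition bottO : C0R2 R :=
  MkC0 bott_off_cont (bott_vanish (fun p p0 => (bott_bound p0).2)).

Definition e11 : 'M[unitization (C0R2 R)]_2 := delta_mx 0 0.

Definition pBott : 'M[unitization (C0R2 R)]_2 :=
  \matrix_(i, j)
    if i == 0 then if j == 0 then (1, - bottD) else (0, bottO)
    else if j == 0 then (0, adj bottO) else (0, bottD).
End Bott.

Section Theories.
Context {R : realType}.
Variables (K : compactOperators R)
  (tens : forall A B : cstarAlgType R, tensorProduct A B).

Local Notation "A ⊗ B" := (tens A B) (at level 40, left associativity).
Local Notation S2 A := (C0R2 R ⊗ A).

(* KK(A,B) = [qA ⊗ K, B ⊗ K]; the free product F stands for A * A. *)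
Definition KK (A : cstarAlgType R) (F : freeProduct A A) (B : cstarAlgType R) :=
  homClass (qalg F ⊗ K) (B ⊗ K).

(* E(A,B) = [[S^2 A ⊗ K, B ⊗ K]] *)
Definition EE (A B : cstarAlgType R) := asympClass (S2 A ⊗ K) (B ⊗ K).

Definition KKgamma (A : cstarAlgType R) (F : freeProduct A A) : KK F A :=
  hclass (sh_tensor (qalg F ⊗ K) (A ⊗ K)
    (qmap F (sh_id A) (sh_zero A A)) (sh_id K)).

Definition KKid (A : cstarAlgType R) (F : freeProduct A A) : KK F (qalg F) :=
  hclass (sh_id (qalg F ⊗ K)).

Definition stabilize (e : K) (x : unitization (C0R2 R)) :
    unitization (C0R2 R ⊗ K) := (x.1, tp_map (C0R2 R ⊗ K) x.2 e).

(* K_0(C_0(R^2)) and K_0(C) are identified with K_0(C_0(R^2) ⊗ K) and K_0(K)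
   through a |-> a ⊗ e, for e a rank-one projection; [1] is then [e]. *)
Definition is_bott (b : asympMor (C0R2 R ⊗ K) K) :=
  exists2 e : K, rank_one_projection e &
    K0_maps b (map_mx (stabilize e) e11) (map_mx (stabilize e) pBott)
      (const_mx (0, e : K) : 'M[unitization K]_1) (0 : 'M[unitization K]_1).

(* bA represents b ⊗ id_A, up to the rearrangement of the tensor factors: an
   asymptotic morphism is determined, up to asymptotic equality and hence up to
   homotopy, by its asymptotic values on elementary tensors. *)
Definition is_bott_tensor_id (A : cstarAlgType R)
    (b : asympMor (C0R2 R ⊗ K) K) (bA : asympMor (S2 A ⊗ K) (A ⊗ K)) :=
  forall (f : C0R2 R) (a : A) (k : K),
    bA t (tp_map (S2 A ⊗ K) (tp_map (S2 A) f a) k)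
      - tp_map (A ⊗ K) a (b t (tp_map (C0R2 R ⊗ K) f k)) @[t --> +oo]
      --> (0 : A ⊗ K).

(* Naturality with respect to all *-homomorphisms B ⊗ K -> C ⊗ K, with B and C
   separable. *)
Definition natural_KK_E (A : cstarAlgType R) (F : freeProduct A A)
    (I : forall B : cstarAlgType R, separable B -> KK F B -> EE A B) :=
  forall (B C : cstarAlgType R) (sB : separable B) (sC : separable C)
    (f : starHom (B ⊗ K) (C ⊗ K)) (x : KK F B),
    I C sC (hcomp (hclass f) x) = acomp (hclass f) (I B sB x).
End Theories.

(* Main.v *)
(* Yoneda: [phi] is the image of [id] in [KK(A, qA)] under postcomposition with
   [phi], so naturality along [phi] itself gives the formula. *)
Require Import Defs.
From mathcomp Require Import all_boot all_algebra generic_quotient complex.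
From mathcomp Require Import all_classical all_reals topology normedtype.

(** [hcomp] composes chosen representatives, and the one chosen for the class of [sh_id A] need not
    be [sh_id A]; [hcompE] removes that choice, and the constant homotopy then suffices. *)
Lemma hcomp_id {R : realType} {A B : cstarAlgType R} (x : homClass A B) :
  hcomp x (hclass (sh_id A)) = x.
Proof.
rewrite -(reprK x); rewrite -[\pi_(_)%qT _]/(hclass (repr x)) hcompE.
by apply/hclassP; exact: (sh_homotopic_refl (repr x)).
Qed.

Theorem theorem1 (R : realType) (K : compactOperators R)
    (tens : forall A B : cstarAlgType R, tensorProduct A B)
    (A : cstarAlgType R) (sA : separable A) (F : freeProduct A A)
    (betaC : asympMor (tens (C0R2 R) K) K) (bott_betaC : is_bott betaC)
    (betaA : asympMor (tens (tens (C0R2 R) A) K) (tens A K))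
    (betaA_tensor : is_bott_tensor_id betaC betaA)
    (I : forall B : cstarAlgType R, separable B -> KK K tens F B -> EE K tens A B)
    (I_natural : natural_KK_E I)
    (I_gamma : I A sA (KKgamma K tens F) = aclass betaA)
    (B : cstarAlgType R) (sB : separable B) (phi : KK K tens F B) :
  I B sB phi = acomp phi (I (qalg F) (qalg_separable F sA) (KKid K tens F)).
Proof.
have phiE : hclass (repr phi) = phi by rewrite /hclass reprK.
(* Naturality is stated for actual homomorphisms, so [phi] becomes the class of [repr phi], a map
   from [qalg F ⊗ K] to [B ⊗ K], applied to [KKid]. *)
by rewrite -[in LHS](hcomp_id phi) -phiE; exact: I_natural.
Qed.
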